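(* Let $x\in G^{w_{\mathrm o},w_{\mathrm o}}$ and $y=\psi^{w_{\mathrm o},w_{\mathrm o}}(x)$, and suppose that all positive quasiminors of $x$ and $y$ appearing below are defined and those that are inverted are nonzero. Then $$\Delta^{n+1-i,i}_{[n+1-i,n],[1,i]}(y)=\Delta^{n+1-i,i}_{[n+1-i,n],[1,i]}(x)\qquad\text{for } i\in[1,n],$$ and for all $1\le i\le j\le n-1$: $$\Delta^{i,j}_{[1,i]\cup[n+i+1-j,n],[1,j]}(y)^{-1}\Delta^{i,j+1}_{[1,i]\cup[n+i-j,n],[1,j+1]}(y)=\Delta^{i,j}_{[1,i],[j+1-i,j]}(x)^{-1}\Delta^{i,j+1}_{[1,i],[j-i+2,j+1]}(x),$$ $$\Delta^{i,j}_{[1,i],[j+1-i,j]}(y)^{-1}\Delta^{i,j+1}_{[1,i],[j-i+2,j+1]}(y)=\Delta^{i,j}_{[1,i]\cup[n+i+1-j,n],[1,j]}(x)^{-1}\Delta^{i,j+1}_{[1,i]\cup[n+i-j,n],[1,j+1]}(x),$$ $$\Delta^{j,j+1-i}_{[1,j],[n+2-i,n]\cup[1,j+1-i]}(y)^{-1}\Delta^{j,n+1-i}_{[1,j],[n+1-i,n]\cup[1,j-i]}(y)=\Delta^{i,j+1-i}_{[i,j],[1,j+1-i]}(x)^{-1}\Delta^{i,n+1-i}_{[i,n],[1,n+1-i]}(x),$$ $$\Delta^{i,j+1-i}_{[i,j],[1,j+1-i]}(y)^{-1}\Delta^{i,n+1-i}_{[i,n],[1,n+1-i]}(y)=\Del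ta^{j,j+1-i}_{[1,j],[n+2-i,n]\cup[1,j+1-i]}(x)^{-1}\Delta^{j,n+1-i}_{[1,j],[n+1-i,n]\cup[1,j-i]}(x).$$
   Context: Let $\mathcal F$ be a skew field, $G=GL_n(\mathcal F)$, $[a,b]=\{a,a+1,\dots,b\}$ (empty if $a>b$), $w_{\mathrm o}=(n,n-1,\dots,1)$ the longest permutation in $S_n$. Quasideterminants: for a square matrix $A=(a_{ij})_{i\in I,j\in J}$, $|A|_{ij}=a_{ij}$ if $|I|=1$; otherwise, if $A^{ij}$ ($A$ with row $i$ and column $j$ deleted) is invertible, $|A|_{ij}=a_{ij}-r_i(A^{ij})^{-1}c_j$, where $r_i$ is row $i$ of $A$ without $a_{ij}$ and $c_j$ is column $j$ of $A$ without $a_{ij}$. Positive quasiminors: for $I,J\subset[1,n]$ with $|I|=|J|$, $i\in I$, $j\in J$, $\Delta^{i,j}_{I,J}(x)=(-1)^{d_i(I)+d_j(J)}|x_{I,J}|_{i,j}$, where $x_{I,J}$ is the submatrix with rows $I$ and columns $J$, and $d_i(I)$ (resp. $d_j(J)$) is the number of elements of $I$ greater than $i$ (resp. of $J$ greater than $j$). Groups: $B$ (resp. $B^-$) is the group of upper (resp. lower) triangular matrices in $G$, $H$ the diagonal matrices in $G$, $U$ the upper unitriangular matrices. Each $x\in B^-U$ is written uniquely as $x=[x]_-[x]_+$ with $[x]_-\in B^-$, $[x]_+\in U$. $S_n$ is embedded in $G$ as permutation matrices ($u e_k=e_{u(k)}$). Let $s_i=(i,i+1)$, let $\overline{s_i}\in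 G$ be the matrix with block $\begin{pmatrix}0&-1\\1&0\end{pmatrix}$ in rows and columns $i,i+1$ and identity elsewhere, and for $w\in S_n$ let $\overline w=\overline{s_{j_1}}\cdots\overline{s_{j_l}}$ for any reduced word $w=s_{j_1}\cdots s_{j_l}$ (independent of the choice). $G^{u,v}=BuB\cap B^-vB^-$, $L^{u,v}=U\overline uU\cap B^-vB^-$; every element of $G^{u,v}$ is uniquely $hx'$ with $h\in H$, $x'\in L^{u,v}$. Positive inverse: $x^\iota=J_nx^{-1}J_n$, $J_n=\mathrm{diag}(-1,1,-1,\dots,(-1)^n)$. Twist: for $x'\in L^{u,v}$, $\psi^{u,v}(x')=([x'\,\overline{v^{-1}}]_-)^\iota\,(x'^\iota)^{-1}\,([\overline u^{\,-1}x']_+)^\iota$, extended to $G^{u,v}$ by $\psi^{u,v}(hx')=h\psi^{u,v}(x')$. *)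

(* Defs.v *)
From HB Require Import structures.
From mathcomp Require Import all_boot all_order all_algebra all_fingroup.
From mathcomp Require Import classical_sets.

Set Implicit Arguments.
Unset Strict Implicit.
Unset Printing Implicit Defensive.

Import GRing.Theory.
Local Open Scope ring_scope.

(* A skew field is an [F : unitRingType] with [GRing.field_axiom F]: unit rings
   are nontrivial and not assumed commutative, and the axiom says that every
   nonzero element is a unit.  MathComp's [unitmx], [invmx] and [\det] require
   commutative coefficients, so inversion of matrices is defined here. *)

Section Inverse.
Variables (F : unitRingType) (m n : nat).

(* The two index sets are not required to be syntactically equal, so that this
   applies to submatrices of type 'M_(#|I|, #|J|). *)
Definition is_inverse (A : 'M[F]_(m, n)) (B : 'M[F]_(n, m)) : Prop :=
  A *m B = 1%:M /\ B *m A = 1%:M.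

Definition invertible (A : 'M[F]_(m, n)) : Prop := exists B, is_inverse A B.

(* Junk value 0 if A is not invertible. *)
Definition minv (A : 'M[F]_(m, n)) : 'M[F]_(n, m) := xget 0 (is_inverse A).

End Inverse.

Section Quasiminors.
Variables (F : unitRingType) (n : nat).
Implicit Types (x : 'M[F]_n) (I J : {set 'I_n}) (i j : 'I_n).

(* Rows I and columns J, listed in increasing order. *)
Definition submatrix x I J : 'M[F]_(#|I|, #|J|) := mxsub enum_val enum_val x.

Definition quasidet_defined x I J i j : Prop :=
  #|I| = 1%N \/ invertible (submatrix x (I :\ i) (J :\ j)).

(* The quasideterminant |x_{I,J}|_{ij}, meaningful if quasidet_defined. *)
Definition quasidet x I J i j : F :=
  if #|I| == 1%N then x i j else
  x i j - ((\row_(b < #|J :\ j|) x i (enum_val b))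
           *m minv (submatrix x (I :\ i) (J :\ j))
           *m (\col_(a < #|I :\ i|) x (enum_val a) j)) 0 0.

Definition num_above I i : nat := #|[set k in I | (i < k)%N]|.

(* Delta^{i,j}_{I,J}(x) *)
Definition Delta I J i j x : F :=
  (-1) ^+ (num_above I i + num_above J j) * quasidet x I J i j.

Definition Delta_defined I J i j x : Prop := quasidet_defined x I J i j.

Definition Delta_nonzero I J i j x : Prop :=
  Delta_defined I J i j x /\ Delta I J i j x != 0.

End Quasiminors.

(* Indices are 1-based in the formulas, while 'I_n is 0-based. *)
Definition itv (n a b : nat) : {set 'I_n} := [set k : 'I_n | (a <= k.+1 <= b)%N].
Arguments itv {n} a b.

(* The element of 'I_m.+1 with 1-based number k, for 1 <= k <= m.+1. *)
Definition idx (m k : nat) : 'I_m.+1 := inord k.-1.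
Arguments idx {m} k.

Section Groups.
Variables (F : unitRingType) (n : nat).
Implicit Types x : 'M[F]_n.

(* [is_trig_mx] is lower triangularity. *)
Definition in_Bminus x : Prop := invertible x /\ is_trig_mx x.
Definition in_B x : Prop := invertible x /\ is_trig_mx x^T.
Definition in_H x : Prop := invertible x /\ is_diag_mx x.
Definition in_U x : Prop := is_trig_mx x^T /\ forall i, x i i = 1.

Definition is_BminusU x (p : 'M[F]_n * 'M[F]_n) : Prop :=
  [/\ in_Bminus p.1, in_U p.2 & x = p.1 *m p.2].

(* [x]_- and [x]_+, meaningful for x in B^- U. *)
Definition gauss_minus x : 'M[F]_n := (xget (0, 0) (is_BminusU x)).1.
Definition gauss_plus x : 'M[F]_n := (xget (0, 0) (is_BminusU x)).2.

(* Row i (0-based) carries the sign (-1)^(i+1). *)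
Definition Jmx : 'M[F]_n := diag_mx (\row_(i < n) (-1) ^+ i.+1).

Definition pos_inv x : 'M[F]_n := Jmx *m minv x *m Jmx.

(* The matrix P with P e_k = e_{u k}; [perm_mx] acts on row vectors, whence
   the inverse. *)
Definition permG (u : 'S_n) : 'M[F]_n := perm_mx (u^-1)%g.

End Groups.

Section WeylLift.
Variable m : nat.

(* s_{j+1} = (j+1, j+2) in 1-based numbering, for j : 'I_m. *)
Definition simple (j : 'I_m) : 'S_m.+1 := tperm (inord j) (inord j.+1).

(* s_{j1} o ... o s_{jl}: the product of 'S_n composes left to right, i.e.
   (s * t) k = t (s k), so the factors are accumulated in reverse. *)
Definition word_perm (ws : seq 'I_m) : 'S_m.+1 :=
  foldr (fun j w => (w * simple j)%g) 1%g ws.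

Definition reduced_word (w : 'S_m.+1) (ws : seq 'I_m) : Prop :=
  word_perm ws = w /\
  forall ws' : seq 'I_m, word_perm ws' = w -> (size ws <= size ws')%N.

Variable F : unitRingType.

Definition simple_bar (j : 'I_m) : 'M[F]_m.+1 :=
  \matrix_(a, b)
    if (a == j :> nat) && (b == j.+1 :> nat) then -1
    else if (a == j.+1 :> nat) && (b == j :> nat) then 1
    else ([&& a == b, a != j :> nat & a != j.+1 :> nat])%:R.

(* The product along a chosen reduced word; it does not depend on the choice. *)
Definition bar (w : 'S_m.+1) : 'M[F]_m.+1 :=
  \big[mulmx/1%:M]_(j <- xget [::] (reduced_word w)) simple_bar j.

End WeylLift.

Section Twist.
Variables (F : unitRingType) (m : nat).
Implicit Types (u v : 'S_m.+1) (x : 'M[F]_m.+1).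

Definition in_BminusvBminus v x : Prop :=
  exists b1 b2, [/\ in_Bminus b1, in_Bminus b2 & x = b1 *m permG F v *m b2].

Definition in_BuB u x : Prop :=
  exists b1 b2, [/\ in_B b1, in_B b2 & x = b1 *m permG F u *m b2].

(* G^{u,v} *)
Definition double_cell u v x : Prop := in_BuB u x /\ in_BminusvBminus v x.

(* L^{u,v} *)
Definition reduced_cell u v x : Prop :=
  (exists a1 a2, [/\ in_U a1, in_U a2 & x = a1 *m bar F u *m a2])
  /\ in_BminusvBminus v x.

Definition twist_reduced u v x : 'M[F]_m.+1 :=
  pos_inv (gauss_minus (x *m bar F (v^-1)%g))
  *m minv (pos_inv x)
  *m pos_inv (gauss_plus (minv (bar F u) *m x)).

Definition is_HL u v x (p : 'M[F]_m.+1 * 'M[F]_m.+1) : Prop :=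
  [/\ in_H p.1, reduced_cell u v p.2 & x = p.1 *m p.2].

(* psi^{u,v}, meaningful on G^{u,v}. *)
Definition twist u v x : 'M[F]_m.+1 :=
  let p := xget (0, 0) (is_HL u v x) in p.1 *m twist_reduced u v p.2.

Definition w0 : 'S_m.+1 := perm (@rev_ord_inj m.+1).

(* All the quasiminors of z in the formulas are defined, and those whose inverse
   is taken are nonzero.  The same list serves for z = x and z = y, since
   each ratio occurs once with x and once with y. *)
Definition quasiminors_ok (z : 'M[F]_m.+1) : Prop :=
  let n := m.+1 in
  (forall i : nat, (1 <= i <= n)%N ->
     Delta_defined (itv (n + 1 - i) n) (itv 1 i) (idx (n + 1 - i)) (idx i) z)
  /\
  (forall i j : nat, (1 <= i)%N -> (i <= j)%N -> (j <= n - 1)%N ->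
     [/\ Delta_nonzero (itv 1 i :|: itv (n + i + 1 - j) n) (itv 1 j)
           (idx i) (idx j) z
       & Delta_defined (itv 1 i :|: itv (n + i - j) n) (itv 1 (j + 1))
           (idx i) (idx (j + 1)) z]
     /\
     [/\ Delta_nonzero (itv 1 i) (itv (j + 1 - i) j) (idx i) (idx j) z
       & Delta_defined (itv 1 i) (itv (j - i + 2) (j + 1))
           (idx i) (idx (j + 1)) z]
     /\
     [/\ Delta_nonzero (itv 1 j) (itv (n + 2 - i) n :|: itv 1 (j + 1 - i))
           (idx j) (idx (j + 1 - i)) z
       & Delta_defined (itv 1 j) (itv (n + 1 - i) n :|: itv 1 (j - i))
           (idx j) (idx (n + 1 - i)) z]
     /\
     [/\ Delta_nonzero (itv i j) (itv 1 (j + 1 - i))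
           (idx i) (idx (j + 1 - i)) z
       & Delta_defined (itv i n) (itv 1 (n + 1 - i))
           (idx i) (idx (n + 1 - i)) z]).

End Twist.

Arguments w0 {m}.

(* Main.v *)
(** If v is a column supported on J with (x v)_a = 0 for all a in I other than i,
    then (x v)_i = |x_{I,J}|_{ij} v_j, and dually for rows.  So an equality of
    quasiminors reduces to moving solutions of such linear systems along
    factorizations of x and y.

    Write x = h x', x' w = L1 U1 and w^-1 x' = L2 U2, with w the lift of w_o and
    M^K = J M J.  As w^-1 = w^K, the matrices Z = L1^-1 x' = U1 w^K and
    V = x' U2^-1 = w L2 vanish below the antidiagonal and have explicit signs on
    it.  Then y = h (Z U2^-1)^K = h (L1^-1 V)^K: x and y are recovered from Z and
    V^K by lower triangular factors on the left, and from V and Z^K, up to h, by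
    upper unitriangular factors on the right.  This description is symmetric
    under (x, Z) <-> (y, V^K), so only three kinds of identity remain.
    Quasiminors in initial rows, resp. columns, are insensitive to the
    corresponding factors, and the zeros of Z and V cut the larger quasiminor
    down to the smaller one. *)
Require Import Defs.
From mathcomp Require Import all_boot all_order all_algebra all_fingroup.
From mathcomp Require Import zify.
From mathcomp Require classical_sets.

Set Implicit Arguments.
Unset Strict Implicit.
Unset Printing Implicit Defensive.

Import GRing.Theory.
Local Open Scope ring_scope.

(** * Quasideterminants as values of linear systems *)

Section Inverses.
Variable F : unitRingType.

Lemma minvP m n (A : 'M[F]_(m, n)) : invertible A -> is_inverse A (minv A).
Proof. by move=> hA; rewrite /minv; apply: classical_sets.xgetPex. Qed.

Lemma minv_eq m n (A : 'M[F]_(m, n)) (B : 'M[F]_(n, m)) :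
  is_inverse A B -> minv A = B.
Proof.
move=> [AB BA]; have [] := minvP (ex_intro _ B (conj AB BA)).
by move=> AM _; rewrite -[LHS]mul1mx -BA -mulmxA AM mulmx1.
Qed.
End Inverses.

Section Quasideterminants.
Variables (F : unitRingType) (n : nat).
Implicit Types (x : 'M[F]_n) (I J : {set 'I_n}) (i j : 'I_n).

(** Restriction to an index set becomes a matrix product, so deleted rows and columns are handled by
    associativity rather than by entrywise sums. *)
Definition coord_incl J : 'M[F]_(n, #|J|) := colsub enum_val 1%:M.
Definition coord_proj I : 'M[F]_(#|I|, n) := rowsub enum_val 1%:M.

Lemma submatrixE x I J : submatrix x I J = coord_proj I *m x *m coord_incl J.
Proof.
rewrite /coord_proj /coord_incl mul_rowsub_mx mul1mx mulmx_colsub mulmx1.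
by apply/matrixP=> a b; rewrite !mxE.
Qed.

Lemma coord_inclE J (w : 'cV[F]_#|J|) b :
  (coord_incl J *m w) b 0 = \sum_k (b == enum_val k)%:R * w k 0.
Proof. by rewrite mxE; apply: eq_bigr => k _; rewrite !mxE. Qed.

Lemma coord_projE I (w : 'rV[F]_#|I|) a :
  (w *m coord_proj I) 0 a = \sum_k w 0 k * (enum_val k == a)%:R.
Proof. by rewrite mxE; apply: eq_bigr => k _; rewrite !mxE. Qed.

Lemma coord_incl_out J (w : 'cV[F]_#|J|) b :
  b \notin J -> (coord_incl J *m w) b 0 = 0.
Proof.
move=> bJ; rewrite coord_inclE big1 // => k _.
case: eqP => [e|]; last by rewrite mul0r.
by rewrite e enum_valP in bJ.
Qed.

Lemma coord_proj_out I (w : 'rV[F]_#|I|) a :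
  a \notin I -> (w *m coord_proj I) 0 a = 0.
Proof.
move=> aI; rewrite coord_projE big1 // => k _.
case: eqP => [e|]; last by rewrite mulr0.
by rewrite -e enum_valP in aI.
Qed.

Lemma mulmx_coord_proj I p (v : 'M[F]_(n, p)) : coord_proj I *m v = rowsub enum_val v.
Proof. by rewrite /coord_proj mul_rowsub_mx mul1mx. Qed.

Lemma mulmx_coord_incl J p (u : 'M[F]_(p, n)) : u *m coord_incl J = colsub enum_val u.
Proof. by rewrite /coord_incl mulmx_colsub mulmx1. Qed.

Lemma coord_projK I p (v : 'M[F]_(n, p)) a b (aI : a \in I) :
  v a b = (coord_proj I *m v) (enum_rank_in aI a) b.
Proof. by rewrite mulmx_coord_proj mxE enum_rankK_in. Qed.

Lemma coord_inclK J p (u : 'M[F]_(p, n)) a b (bJ : b \in J) :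
  u a b = (u *m coord_incl J) a (enum_rank_in bJ b).
Proof. by rewrite mulmx_coord_incl mxE enum_rankK_in. Qed.

(** Columns form a right module over [F], while [*:] scales on the left; the coefficient at [j] is
    therefore a 1 by 1 matrix placed on the right. *)
Lemma supp_col_decomp J j (v : 'cV[F]_n) : j \in J ->
  (forall b, b \notin J -> v b 0 = 0) ->
  v = delta_mx j 0 *m (v j 0)%:M + coord_incl (J :\ j) *m (coord_proj (J :\ j) *m v).
Proof.
move=> jJ vJ; apply/colP=> b; rewrite mxE coord_inclE mulmx_coord_proj.
rewrite mxE big_ord1 !mxE eqxx andbT mulr1n.
under eq_bigr do rewrite mxE.
rewrite -(big_enum_val (fun c => (b == c)%:R * v c 0)) /=.
have [->|nbj] := eqVneq b j.
  rewrite mul1r big1 ?addr0 // => c; rewrite !inE => /andP[cj _].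
  by rewrite eq_sym (negPf cj) mul0r.
rewrite mul0r add0r; have [bJ|bJ] := boolP (b \in J).
  rewrite (bigD1 b) ?inE ?nbj //= eqxx mul1r big1 ?addr0 // => c /andP[_ cb].
  by rewrite eq_sym (negPf cb) mul0r.
rewrite vJ // big1 // => c; rewrite !inE => /andP[_ cJ].
by case: eqP => [e|]; rewrite ?mul0r // e cJ in bJ *.
Qed.

Lemma supp_row_decomp I i (u : 'rV[F]_n) : i \in I ->
  (forall a, a \notin I -> u 0 a = 0) ->
  u = (u 0 i)%:M *m delta_mx 0 i + (u *m coord_incl (I :\ i)) *m coord_proj (I :\ i).
Proof.
move=> iI uI; apply/rowP=> b; rewrite mxE coord_projE mulmx_coord_incl.
rewrite mxE big_ord1 !mxE eqxx mulr1n.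
under eq_bigr do rewrite mxE.
rewrite -(big_enum_val (fun c => u 0 c * (c == b)%:R)) /=.
have [->|nbj] := eqVneq b i.
  rewrite mulr1 big1 ?addr0 // => c; rewrite !inE => /andP[cj _].
  by rewrite (negPf cj) mulr0.
rewrite mulr0 add0r; have [bJ|bJ] := boolP (b \in I).
  rewrite (bigD1 b) ?inE ?nbj //= eqxx mulr1 big1 ?addr0 // => c /andP[_ cb].
  by rewrite (negPf cb) mulr0.
rewrite uI // big1 // => c; rewrite !inE => /andP[_ cJ].
by case: eqP => [e|]; rewrite ?mulr0 // -e cJ in bJ *.
Qed.

Lemma quasidetE x I J i j : #|I| != 1%N ->
  quasidet x I J i j = (row i x *m delta_mx j 0
    - row i x *m coord_incl (J :\ j) *m minv (submatrix x (I :\ i) (J :\ j))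
      *m (coord_proj (I :\ i) *m col j x)) 0 0.
Proof.
rewrite /quasidet => /negPf ->; rewrite [RHS]mxE [X in _ = _ + X]mxE; congr (_ - _).
  by rewrite -colE !mxE.
congr ((_ *m _ *m _) 0 0); last by apply/colP=> k; rewrite mulmx_coord_proj !mxE.
by apply/rowP=> k; rewrite mulmx_coord_incl !mxE.
Qed.

(** The rows [I :\ i] express the entries of [v] off [j] as right multiples of [v j 0], through the
    left inverse of the submatrix. Substituting them into row [i] leaves the Schur complement. *)
Lemma quasidet_col x I J i j (v : 'cV[F]_n) :
  quasidet_defined x I J i j -> i \in I -> j \in J -> #|I| = #|J| ->
  (forall b, b \notin J -> v b 0 = 0) ->
  (forall a, a \in I -> a != i -> (x *m v) a 0 = 0) ->
  (x *m v) i 0 = quasidet x I J i j * v j 0.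
Proof.
move=> D iI jJ cIJ vJ xv0; have [I1|I1] := eqVneq #|I| 1%N.
  rewrite /quasidet I1 eqxx mxE (bigD1 j) //= big1 ?addr0 // => b bj.
  rewrite vJ ?mulr0 //; move: jJ; have/eqP/cards1P[c ->] : #|J| = 1%N by rewrite -cIJ.
  by rewrite !inE => /eqP jc; rewrite -jc.
case: D => [/eqP D|/minvP[_]]; first by rewrite D in I1.
rewrite quasidetE //; set N := minv _ => NM.
have dec := supp_col_decomp jJ vJ.
have xv0' : coord_proj (I :\ i) *m (x *m v) = 0.
  apply/colP=> k; rewrite mulmx_coord_proj !mxE -[RHS](xv0 (enum_val k)) ?mxE //;
    by have := enum_valP k; rewrite !inE => /andP[].
have e : coord_proj (J :\ j) *m v
    = - (N *m (coord_proj (I :\ i) *m (x *m delta_mx j 0)) *m (v j 0)%:M).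
  apply/eqP; rewrite -addr_eq0 addrC; apply/eqP.
  rewrite -[X in _ + X]mul1mx -NM submatrixE -!mulmxA -!mulmxDr -dec xv0'.
  by rewrite mulmx0.
transitivity (((row i x *m delta_mx j 0
    - row i x *m coord_incl (J :\ j) *m N
      *m (coord_proj (I :\ i) *m col j x)) *m (v j 0)%:M) 0 0).
  have rowi (M : 'cV[F]_n) : M i 0 = ((delta_mx 0 i : 'rV_n) *m M) 0 0
    by rewrite -rowE mxE.
  by rewrite rowi {1}dec e rowE colE !(mulmxDr, mulmxDl, mulmxN, mulNmx) !mulmxA.
by rewrite mxE big_ord1 [_%:M _ _]mxE mulr1n.
Qed.

Lemma quasidet_row x I J i j (u : 'rV[F]_n) :
  quasidet_defined x I J i j -> i \in I -> j \in J -> #|I| = #|J| ->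
  (forall a, a \notin I -> u 0 a = 0) ->
  (forall b, b \in J -> b != j -> (u *m x) 0 b = 0) ->
  (u *m x) 0 j = u 0 i * quasidet x I J i j.
Proof.
move=> D iI jJ cIJ uI ux0; have [I1|I1] := eqVneq #|I| 1%N.
  rewrite /quasidet I1 eqxx mxE (bigD1 i) //= big1 ?addr0 // => b bj.
  rewrite uI ?mul0r //; move: iI; have/eqP/cards1P[c ->] := I1.
  by rewrite !inE => /eqP jc; rewrite -jc.
case: D => [/eqP D|/minvP[]]; first by rewrite D in I1.
rewrite quasidetE //; set N := minv _ => MN _.
have dec := supp_row_decomp iI uI.
have ux0' : u *m x *m coord_incl (J :\ j) = 0.
  apply/rowP=> k; rewrite mulmx_coord_incl !mxE -[RHS](ux0 (enum_val k)) ?mxE //;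
    by have := enum_valP k; rewrite !inE => /andP[].
have e : u *m coord_incl (I :\ i)
    = - ((u 0 i)%:M *m (delta_mx 0 i *m x *m coord_incl (J :\ j) *m N)).
  apply/eqP; rewrite -addr_eq0 addrC; apply/eqP.
  rewrite -[X in _ + X]mulmx1 -MN submatrixE !mulmxA -!mulmxDl -dec.
  by rewrite ux0' mul0mx.
transitivity (((u 0 i)%:M *m (row i x *m delta_mx j 0
    - row i x *m coord_incl (J :\ j) *m N
      *m (coord_proj (I :\ i) *m col j x))) 0 0).
  have colj (M : 'rV[F]_n) : M 0 j = (M *m (delta_mx j 0 : 'cV_n)) 0 0 by rewrite -colE mxE.
  by rewrite colj {1}dec e rowE colE !(mulmxDr, mulmxDl, mulmxN, mulNmx) !mulmxA.
by rewrite mxE big_ord1 [_%:M _ _]mxE mulr1n.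
Qed.

(** Here the right inverse of the submatrix is what matters. The normalized solutions serve as test
    vectors, to be carried from one matrix of a twist pair to the other. *)
Lemma quasidet_col_exists x I J i j :
  quasidet_defined x I J i j -> i \in I -> j \in J -> #|I| = #|J| ->
  exists v : 'cV[F]_n, [/\ v j 0 = 1, forall b, b \notin J -> v b 0 = 0
    & forall a, a \in I -> a != i -> (x *m v) a 0 = 0].
Proof.
move=> D iI jJ cIJ; have [I1|I1] := eqVneq #|I| 1%N.
  exists (delta_mx j 0); split=> [|b bJ|a]; first by rewrite !mxE !eqxx.
  - by rewrite !mxE andbT; case: eqP => // e; rewrite e jJ in bJ.
  - have/eqP/cards1P[c e] := I1; move: iI; rewrite e !inE => /eqP -> /eqP -> .
    by rewrite eqxx.
case: D => [/eqP D|/minvP[MN _]]; first by rewrite D in I1.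
set N := minv _ in MN.
exists (delta_mx j 0 - coord_incl (J :\ j) *m (N *m (coord_proj (I :\ i) *m col j x))).
split=> [|b bJ|a aI ai].
- by rewrite mxE [X in _ + X]mxE; rewrite coord_incl_out ?mxE ?inE ?eqxx // subr0.
- rewrite mxE [X in _ + X]mxE coord_incl_out ?inE ?(negPf bJ) ?andbF // subr0 mxE andbT.
  by case: eqP => // e; rewrite e jJ in bJ.
have aIi : a \in I :\ i by rewrite !inE ai.
rewrite (coord_projK _ _ aIi) mulmxBr.
have E (z : 'cV_#|J :\ j|) : coord_proj (I :\ i) *m (x *m (coord_incl (J :\ j) *m z))
    = submatrix x (I :\ i) (J :\ j) *m z by rewrite submatrixE !mulmxA.
by rewrite mulmxBr E (mulmxA _ N) MN mul1mx colE subrr mxE.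
Qed.

Lemma quasidet_row_exists x I J i j :
  quasidet_defined x I J i j -> i \in I -> j \in J -> #|I| = #|J| ->
  exists u : 'rV[F]_n, [/\ u 0 i = 1, forall a, a \notin I -> u 0 a = 0
    & forall b, b \in J -> b != j -> (u *m x) 0 b = 0].
Proof.
move=> D iI jJ cIJ; have [I1|I1] := eqVneq #|I| 1%N.
  exists (delta_mx 0 i); split=> [|a aI|b]; first by rewrite !mxE !eqxx.
  - by rewrite !mxE eqxx; case: eqP => // e; rewrite e iI in aI.
  - move: I1; rewrite cIJ => /eqP/cards1P[c e]; move: jJ; rewrite e !inE => /eqP -> /eqP ->.
    by rewrite eqxx.
case: D => [/eqP D|/minvP[_ NM]]; first by rewrite D in I1.
set N := minv _ in NM.
exists (delta_mx 0 i - row i x *m coord_incl (J :\ j) *m N *m coord_proj (I :\ i)).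
split=> [|a aI|b bJ bj].
- by rewrite mxE [X in _ + X]mxE; rewrite coord_proj_out ?mxE ?inE ?eqxx // subr0.
- rewrite mxE [X in _ + X]mxE coord_proj_out ?inE ?(negPf aI) ?andbF // subr0 mxE eqxx.
  by case: eqP => // e; rewrite e iI in aI.
have bJj : b \in J :\ j by rewrite !inE bj.
rewrite (coord_inclK _ _ bJj) mulmxBl.
have E (z : 'rV_#|I :\ i|) : z *m coord_proj (I :\ i) *m x *m coord_incl (J :\ j)
    = z *m submatrix x (I :\ i) (J :\ j) by rewrite submatrixE !mulmxA.
by rewrite mulmxBl E -(mulmxA _ N) NM mulmx1 rowE subrr mxE.
Qed.

End Quasideterminants.

(** * Quasiminors of a twist pair *)

Section Intervals.
Variable m : nat.
Local Notation n := m.+1.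

Lemma idxK k : (1 <= k <= n)%N -> (idx k : 'I_n) = k.-1 :> nat.
Proof. by case: k => // k hk; rewrite /idx inordK. Qed.

Lemma eq_idx (a : 'I_n) k : (1 <= k <= n)%N -> (a == idx k) = (a.+1 == k).
Proof. by move=> hk; rewrite -val_eqE /= idxK //; lia. Qed.

(** Truncated subtraction covers empty intervals, such as [itv (n + i + 1 - j) n] for [j = i]. *)
Lemma card_itv a b : (1 <= a)%N -> (b <= n)%N -> #|@itv n a b| = (b.+1 - a)%N.
Proof.
move=> a1; elim: b => [|b IHb] hb.
  by apply/eqP; rewrite (_ : 1 - a = 0)%N ?cards_eq0; [apply/eqP/setP=> k; rewrite !inE|]; lia.
case: (leqP a b.+1) => ab; last first.
  rewrite (_ : b.+2 - a = 0)%N; last by lia.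
  by apply/eqP; rewrite cards_eq0; apply/eqP/setP=> k; rewrite !inE; lia.
have -> : @itv n a b.+1 = idx b.+1 |: itv a b.
  by apply/setP=> k; rewrite !inE eq_idx; lia.
by rewrite cardsU1 IHb ?inE ?idxK; lia.
Qed.

(** The index [c] may lie outside the interval: in a union of two intervals the pivot belongs to one
    of them and is compared with both. *)
Lemma num_above_itv a b c : (1 <= a)%N -> (b <= n)%N -> (1 <= c <= n)%N ->
  num_above (itv a b) (idx c : 'I_n) = (b - maxn c a.-1)%N.
Proof.
move=> a1 bn cn; rewrite /num_above.
have -> : [set k in @itv n a b | ((idx c : 'I_n) < k)%N] = @itv n (maxn c.+1 a) b.
  by apply/setP=> k; rewrite !inE idxK //; lia.
by rewrite card_itv //; lia.
Qed.

Lemma disjoint_itv a b c e : (b < c)%N || (e < a)%N -> [disjoint @itv n a b & itv c e].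
Proof.
move=> bc; rewrite -setI_eq0; apply/eqP/setP=> k; rewrite !inE; lia.
Qed.

Lemma num_aboveU (A B : {set 'I_n}) c : [disjoint A & B] ->
  num_above (A :|: B) c = (num_above A c + num_above B c)%N.
Proof.
move=> AB; rewrite /num_above.
have -> : [set k in A :|: B | (c < k)%N]
    = [set k in A | (c < k)%N] :|: [set k in B | (c < k)%N].
  by apply/setP=> k; rewrite !inE andb_orl.
rewrite cardsU (_ : _ :&: _ = set0) ?cards0 ?subn0 //.
apply/setP=> k; rewrite !inE; have /pred0P/(_ k)/= := AB.
by case: (k \in A); case: (k \in B); rewrite ?andbF.
Qed.

Lemma card_itvU a b c e : (b < c)%N || (e < a)%N -> (1 <= a)%N -> (b <= n)%N ->
  (1 <= c)%N -> (e <= n)%N ->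
  #|@itv n a b :|: itv c e| = (b.+1 - a + (e.+1 - c))%N.
Proof.
move=> bc a1 bn c1 en; have := disjoint_itv bc; rewrite -leq_card_setU => /eqP ->.
by rewrite !card_itv.
Qed.

End Intervals.

(** * Conjugation by the sign matrix *)

Section Signs.
Variable F : unitRingType.

Lemma eq_sign p q : odd p = odd q -> (-1) ^+ p = (-1) ^+ q :> F.
Proof. by move=> e; rewrite -signr_odd e signr_odd. Qed.

Lemma Jmx_sandwichE n (M : 'M[F]_n) a b :
  (Jmx F n *m M *m Jmx F n) a b = (-1) ^+ (a + b) * M a b.
Proof.
rewrite /Jmx mul_mx_diag mul_diag_mx !mxE -mulrA commr_sign mulrA -exprD.
by congr (_ * _); apply: eq_sign; lia.
Qed.

Lemma Jmx_invol n : Jmx F n *m Jmx F n = 1%:M.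
Proof.
apply/matrixP=> a b; rewrite /Jmx mul_diag_mx !mxE; case: eqP => [->|]; last by rewrite mulr0.
by rewrite mulr1n -exprD -signr_odd addnn odd_double.
Qed.

Lemma Jmx_sandwichM n (M N : 'M[F]_n) :
  Jmx F n *m (M *m N) *m Jmx F n
  = (Jmx F n *m M *m Jmx F n) *m (Jmx F n *m N *m Jmx F n).
Proof. by rewrite !mulmxA -(mulmxA (Jmx F n *m M) (Jmx F n)) Jmx_invol mulmx1. Qed.

Lemma Jmx_sandwichK n (M : 'M[F]_n) :
  Jmx F n *m (Jmx F n *m M *m Jmx F n) *m Jmx F n = M.
Proof. by rewrite !mulmxA Jmx_invol mul1mx -mulmxA Jmx_invol mulmx1. Qed.

Lemma sign_unit p : ((-1) ^+ p : F) \is a GRing.unit.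
Proof. by rewrite unitrX // unitrN1. Qed.
End Signs.

(** * Quasiminor identities from a one-sided relation *)

Section TwistPairs.
Variables (F : unitRingType) (m : nat).
Local Notation n := m.+1.
Local Notation K M := (Jmx F n *m M *m Jmx F n).
Implicit Types x y A B S T Y Z : 'M[F]_n.

(** The common shape of Z and V^K in 0-based indices; the antidiagonal is that of the inverse of the
    lift of [w0]. *)
Definition anti_triangular Y : Prop :=
  (forall a b : 'I_n, (m < a + b)%N -> Y a b = 0)
  /\ forall a b : 'I_n, (a + b = m)%N -> Y a b = (-1) ^+ a.

(* Holds for (x, y) and for (y, x) when y is the twist of x; [d] is the common
   H-component of x and y. *)
Definition half_related (d : 'rV[F]_n) A T x y : Prop :=
  [/\ is_trig_mx A, forall a, A a a \is a GRing.unit, in_U T,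
    anti_triangular (A *m x) & y *m T = diag_mx d *m K (A *m x)].

(** Column [i] of [T] is supported on the first [i] indices with last entry 1, and [x] maps it to a
    column that vanishes below the antidiagonal. So it solves the system, and the value depends on
    [d] alone, which [x] and [y] share. *)
Lemma antidiag_Delta d A T x y i : half_related d A T y x -> (1 <= i <= n)%N ->
  Delta_defined (itv (n + 1 - i) n) (itv 1 i) (idx (n + 1 - i)) (idx i) x ->
  Delta (itv (n + 1 - i) n) (itv 1 i) (idx (n + 1 - i)) (idx i) x
  = d 0 (idx (n + 1 - i)).
Proof.
case=> [_ _ [/is_trig_mxP T0 T1] [Y0 Y1] xT] hi D.
have xvE a : (x *m col (idx i) T) a 0
    = d 0 a * ((-1) ^+ (a + i.-1) * (A *m y) a (idx i)).
  by rewrite colE mulmxA -colE mxE xT mul_diag_mx mxE Jmx_sandwichE idxK.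
have iI : idx (n + 1 - i) \in @itv n (n + 1 - i) n by rewrite inE idxK; lia.
have iJ : idx i \in @itv n 1 i by rewrite inE idxK; lia.
have cIJ : #|@itv n (n + 1 - i) n| = #|@itv n 1 i| by rewrite !card_itv; lia.
have vJ b : b \notin itv 1 i -> col (idx i) T b 0 = 0.
  by rewrite inE => hb; rewrite mxE -[RHS](T0 (idx i) b) ?mxE // idxK; lia.
have xv0 a : a \in itv (n + 1 - i) n -> a != idx (n + 1 - i) ->
    (x *m col (idx i) T) a 0 = 0.
  rewrite inE eq_idx ?xvE; try lia.
  by move=> ha ai; rewrite Y0 ?mulr0 // idxK; lia.
have := quasidet_col D iI iJ cIJ vJ xv0.
rewrite xvE Y1 ?idxK; try lia.
rewrite [col _ _ _ _]mxE T1 mulr1 /Delta => <-.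
rewrite !num_above_itv; try lia.
(* Conjugation and the antidiagonal sign together give exponent [i - 1] modulo 2, which is also the
   exponent in [Delta]. *)
rewrite -exprD -commr_sign -!mulrA -!exprD.
by rewrite (@eq_sign _ _ 0) ?mulr1 //; lia.
Qed.

(** A triangular factor preserves the end of a support and changes the entry there only by its
    diagonal. This and the next two lemmas carry test vectors through [A] and [T]. *)
Lemma lower_mulr_supp A (g : 'rV[F]_n) (a : 'I_n) : is_trig_mx A ->
  (forall k : 'I_n, (a < k)%N -> g 0 k = 0) ->
  (forall k : 'I_n, (a < k)%N -> (g *m A) 0 k = 0)
  /\ (g *m A) 0 a = g 0 a * A a a.
Proof.
move=> /is_trig_mxP A0 g0; split=> [k ak|]; rewrite mxE.
  apply: big1 => l _; case: (ltnP a l) => al; first by rewrite g0 ?mul0r.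
  by rewrite A0 ?mulr0 //; lia.
rewrite (bigD1 a) //= big1 ?addr0 // => l la.
case: (ltnP a l) => al; first by rewrite g0 ?mul0r.
by rewrite A0 ?mulr0 // ltn_neqAle al andbT.
Qed.

Lemma upper_mull_supp T (g : 'cV[F]_n) (a : 'I_n) : in_U T ->
  (forall k : 'I_n, (a < k)%N -> g k 0 = 0) ->
  (forall k : 'I_n, (a < k)%N -> (T *m g) k 0 = 0)
  /\ (T *m g) a 0 = g a 0.
Proof.
move=> [/is_trig_mxP T0 T1] g0; split=> [k ak|]; rewrite mxE.
  apply: big1 => l _; case: (ltnP a l) => al; first by rewrite g0 ?mulr0.
  by have := T0 l k; rewrite mxE => ->; rewrite ?mul0r //; lia.
rewrite (bigD1 a) //= big1 ?addr0 ?T1 ?mul1r // => l la.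
case: (ltnP a l) => al; first by rewrite g0 ?mulr0.
by have := T0 l a; rewrite mxE => ->; rewrite ?mul0r // ltn_neqAle al andbT.
Qed.

Lemma upper_mulr_init T (g : 'rV[F]_n) (a : 'I_n) : in_U T ->
  (forall k : 'I_n, (k < a)%N -> g 0 k = 0) ->
  (forall k : 'I_n, (k < a)%N -> (g *m T) 0 k = 0)
  /\ (g *m T) 0 a = g 0 a.
Proof.
move=> [/is_trig_mxP T0 T1] g0; split=> [k ak|]; rewrite mxE.
  apply: big1 => l _; case: (ltnP l a) => al; first by rewrite g0 ?mul0r.
  by have := T0 k l; rewrite mxE => ->; rewrite ?mulr0 //; lia.
rewrite (bigD1 a) //= big1 ?addr0 ?T1 ?mulr1 // => l la.
case: (ltnP l a) => al; first by rewrite g0 ?mul0r.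
by have := T0 a l; rewrite mxE => ->; rewrite ?mulr0 // ltn_neqAle al andbT eq_sym.
Qed.

(** A row test vector for [y] passes through [T], is truncated, and passes through [A] to become one
    for [x]. The resulting factor is independent of [j], so it cancels in the ratio of the
    quasiminors for [j] and [j + 1]. *)
Lemma top_rows_Delta d A T x y i j : half_related d A T x y ->
  (1 <= i)%N -> (i <= j)%N -> (j <= n)%N ->
  Delta_defined (itv 1 i) (itv (j + 1 - i) j) (idx i) (idx j) x ->
  Delta_defined (itv 1 i :|: itv (n + i + 1 - j) n) (itv 1 j) (idx i) (idx j) y ->
  d 0 (idx i) * A (idx i) (idx i)
    * Delta (itv 1 i) (itv (j + 1 - i) j) (idx i) (idx j) x
  = Delta (itv 1 i :|: itv (n + i + 1 - j) n) (itv 1 j) (idx i) (idx j) y.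
Proof.
move=> [trigA _ UT [Z0 Z1] yT] i1 ij jn Dx Dy.
have iI' : idx i \in @itv n 1 i :|: itv (n + i + 1 - j) n by rewrite !inE idxK; lia.
have jJ' : idx j \in @itv n 1 j by rewrite inE idxK; lia.
have cIJ' : #|@itv n 1 i :|: itv (n + i + 1 - j) n| = #|@itv n 1 j|.
  by rewrite card_itvU ?card_itv; lia.
have [t [t1 tI ty0]] := quasidet_row_exists Dy iI' jJ' cIJ'.
have qy := quasidet_row Dy iI' jJ' cIJ' tI ty0; rewrite t1 mul1r in qy.
have [|s0 s1] := @upper_mulr_init T (t *m y) (idx j) UT.
  move=> k; rewrite idxK; last by lia.
  by move=> kj; apply: ty0; rewrite ?inE ?eq_idx; lia.
(* The rows n+i+1-j..n of A x vanish in the columns j+1-i..j, so t may be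
   truncated to its first i entries. *)
pose g : 'rV[F]_n := \row_k (if (k < i)%N then t 0 k * d 0 k * (-1) ^+ k else 0).
have gZ b : b \in @itv n (j + 1 - i) j ->
    (g *m (A *m x)) 0 b = (-1) ^+ b * (t *m y *m T) 0 b.
  rewrite inE => hb; rewrite -(mulmxA t) yT mxE [in RHS]mxE mulr_sumr.
  apply: eq_bigr => k _; rewrite mul_diag_mx [X in _ * (_ * X)]mxE Jmx_sandwichE.
  rewrite mxE; case: ifP => ki.
    rewrite !mulrA -(commr_sign (t 0 k)) -!mulrA; congr (_ * _).
    rewrite [in RHS]mulrA -(commr_sign (d 0 k)) -!mulrA; congr (_ * _).
    by rewrite mulrA -exprD; congr (_ * _); apply: eq_sign; lia.
  case: (leqP (n + i + 1 - j) k.+1) => hk; last first.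
    by rewrite tI ?mul0r ?mulr0 // !inE; lia.
  by rewrite Z0 ?mulr0 //; lia.
have [|u0 u1] := @lower_mulr_supp A g (idx i) trigA.
  move=> k; rewrite idxK; last by lia.
  by move=> ki; rewrite mxE ifN //; lia.
have iI : idx i \in @itv n 1 i by rewrite inE idxK; lia.
have jJ : idx j \in @itv n (j + 1 - i) j by rewrite inE idxK; lia.
have cIJ : #|@itv n 1 i| = #|@itv n (j + 1 - i) j| by rewrite !card_itv; lia.
have uI a : a \notin itv 1 i -> (g *m A) 0 a = 0.
  by rewrite inE => ai; apply: u0; rewrite idxK; lia.
have ux0 b : b \in itv (j + 1 - i) j -> b != idx j -> (g *m A *m x) 0 b = 0.
  move=> hb bj; rewrite -mulmxA gZ // s0 ?mulr0 // idxK; last by lia.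
  by move: hb bj; rewrite inE eq_idx; lia.
have := quasidet_row Dx iI jJ cIJ uI ux0.
rewrite u1 -mulmxA gZ // s1 qy mxE !idxK; try lia.
rewrite ifT; last by lia.
rewrite t1 mul1r /Delta.
rewrite num_aboveU ?disjoint_itv; try lia.
rewrite !num_above_itv; try lia.
(* For [x] both pivots are maximal and the sign is trivial; for [y] the [j - i] rows beyond [i] give
   the sign. *)
move=> e; rewrite (@eq_sign _ _ 0) ?mul1r; last by lia.
rewrite (@eq_sign _ _ (i.-1 + j.-1)); last by lia.
rewrite exprD -[in RHS]mulrA e !mulrA; congr (_ * _ * _).
by rewrite -commr_sign -mulrA -exprD (@eq_sign _ _ 0) ?mulr1 //; lia.
Qed.

(** The two quasiminors of [y] share their rows, and their column sets differ by exchanging [k] and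
    [n + 1 - i]. Their ratio is thus the coefficient of a linear relation among columns of [y] in
    the first [j] rows, and this relation survives multiplication by the lower triangular [A]. *)
Lemma left_columns_quasidet d A T x y i j : half_related d A T y x ->
  (1 <= i)%N -> (i <= j)%N -> (j <= m)%N ->
  let k := (j + 1 - i)%N in
  let Jden : {set 'I_n} := itv (n + 2 - i) n :|: itv 1 k in
  let Jnum : {set 'I_n} := itv (n + 1 - i) n :|: itv 1 (j - i) in
  quasidet_defined x (itv i j) (itv 1 k) (idx i) (idx k) ->
  quasidet_defined y (itv 1 j) Jden (idx j) (idx k) ->
  quasidet_defined y (itv 1 j) Jnum (idx j) (idx (n + 1 - i)) ->
  quasidet y (itv 1 j) Jden (idx j) (idx k) \is a GRing.unit ->
  d 0 (idx i) = quasidet x (itv i j) (itv 1 k) (idx i) (idx k)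
    * ((-1) ^+ (j - i) * ((quasidet y (itv 1 j) Jden (idx j) (idx k))^-1
       * quasidet y (itv 1 j) Jnum (idx j) (idx (n + 1 - i)))).
Proof.
move=> [trigA _ UT [Y0 Y1] xT] i1 ij jm k Jden Jnum.
have ek : k = (j + 1 - i)%N by [].
have jI : idx j \in @itv n 1 j by rewrite inE idxK; lia.
have kJ : idx k \in Jden by rewrite !inE idxK; lia.
have cJ : #|@itv n 1 j| = #|Jden| by rewrite card_itvU ?card_itv; lia.
have lJ : idx (n + 1 - i) \in Jnum by rewrite !inE idxK; lia.
have cJ' : #|@itv n 1 j| = #|Jnum| by rewrite card_itvU ?card_itv; lia.
have iI : idx i \in @itv n i j by rewrite inE idxK; lia.
have kK : idx k \in @itv n 1 k by rewrite inE idxK; lia.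
have cIK : #|@itv n i j| = #|@itv n 1 k| by rewrite !card_itv; lia.
have vi : (idx i : 'I_n) = i.-1 :> nat by apply: (@idxK m); lia.
have vj : (idx j : 'I_n) = j.-1 :> nat by apply: (@idxK m); lia.
have vk : (idx k : 'I_n) = (j - i)%N :> nat by rewrite (@idxK m); lia.
set l : 'I_n := idx (n + 1 - i) in lJ *.
have vl : l = (m - i.-1)%N :> nat by rewrite (@idxK m); lia.
have memden (b : 'I_n) : (b \in Jden) = (m - i.-1 < b)%N || (b < k)%N.
  by have := ltn_ord b; rewrite !inE; lia.
have memnum (b : 'I_n) : (b \in Jnum) = (m - i.-1 <= b)%N || (b < k.-1)%N.
  by have := ltn_ord b; rewrite !inE; lia.
clearbody l Jden Jnum k => Dx Dyd Dyn uq.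
have [q [q1 qJ yq0]] := quasidet_col_exists Dyd jI kJ cJ.
have := quasidet_col Dyd jI kJ cJ qJ yq0; rewrite q1 mulr1 => yqE.
have [p [p1 pJ yp0]] := quasidet_col_exists Dyn jI lJ cJ'.
have := quasidet_col Dyn jI lJ cJ' pJ yp0; rewrite p1 mulr1 => ypE.
rewrite -yqE in uq *; rewrite -ypE.
(* The combination r = p - q c of the solutions for the two quasiminors of y is
   killed by the rows 1..j; its part z in the columns 1..k, conjugated by J
   and multiplied by T, solves the system of the quasiminor of x. *)
have [c cE] : exists c, c = ((y *m q) (idx j) 0)^-1 * (y *m p) (idx j) 0 by eexists.
rewrite -cE.
have [r rE yrE] : exists2 r : 'cV[F]_n, forall b, r b 0 = p b 0 - q b 0 * c
    & forall a, (y *m r) a 0 = (y *m p) a 0 - (y *m q) a 0 * c.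
  exists (p - q *m c%:M) => b; rewrite ?mulmxBr ?mulmxA mxE [X in _ + X]mxE;
    by rewrite [X in _ - X]mxE big_ord1 [c%:M _ _]mxE mulr1n.
have yr0 (a : 'I_n) : (a < j)%N -> (y *m r) a 0 = 0.
  move=> aj; rewrite yrE; have [->|aj'] := eqVneq a (idx j).
    by rewrite cE mulVKr ?subrr.
  by rewrite yp0 ?yq0 ?mul0r ?subr0 // inE.
have Yr0 (a : 'I_n) : (a < j)%N -> (A *m y *m r) a 0 = 0.
  move=> aj; rewrite -mulmxA mxE big1 // => b _.
  case: (ltnP b j) => bj; first by rewrite yr0 ?mulr0.
  by rewrite (is_trig_mxP trigA) ?mul0r // (leq_trans aj).
have [z zE] : exists z : 'cV[F]_n,
    forall b, z b 0 = if (b < k)%N then (-1) ^+ b * r b 0 else 0.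
  by exists (\col_b (if (b < k)%N then (-1) ^+ b * r b 0 else 0)) => b; rewrite mxE.
(* In these rows [A *m y] vanishes beyond column [l], and [r] vanishes strictly between the first
   [k] columns and [l]. The relation thus equates the part in the first [k] columns with minus
   column [l], where [r] is 1. *)
have xvE (a : 'I_n) : (i <= a.+1 <= j)%N ->
    (x *m (T *m z)) a 0 = - (d 0 a * ((-1) ^+ a * (A *m y) a l)).
  move=> /andP[ia aj]; rewrite mulmxA xT -mulmxA mul_diag_mx mxE -mulrN; congr (_ * _).
  have {aj} := Yr0 a aj; rewrite mxE => e0.
  have -> : - ((-1) ^+ a * (A *m y) a l)
      = \sum_b (-1) ^+ a * ((A *m y) a b * r b 0 - (A *m y) a b * (b == l)%:R).
    rewrite -mulr_sumr sumrB e0 sub0r mulrN; congr (- (_ * _)).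
    rewrite (bigD1 l) //= eqxx mulr1 big1 ?addr0 // => b /negPf ->.
    by rewrite mulr0.
  rewrite mxE; apply: eq_bigr => b _.
  rewrite Jmx_sandwichE zE exprD -!mulrA; congr (_ * _).
  case: ifP => bk.
    have -> : (b == l) = false.
      by rewrite -val_eqE /= vl; clear -bk ek i1 ij jm; lia.
    rewrite mulr0 subr0 [X in _ * X]mulrA commr_sign -(mulrA _ _ (r b 0)) mulrA -exprD.
    by rewrite (@eq_sign _ _ 0) ?mul1r // addnn odd_double.
  have [->|bl] := eqVneq b l.
    rewrite rE p1 qJ ?mul0r ?subr0 ?subrr ?mulr0 // memden vl.
    by clear -ek i1 ij jm; lia.
  rewrite !mulr0 subr0; have {}bl : (b != l :> nat) by rewrite val_eqE.
  case: (ltnP l b) => lb; first by rewrite Y0 ?mul0r //; clear -lb vl ia i1 ij jm; lia.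
  rewrite rE pJ ?qJ ?mul0r ?subr0 ?mulr0 // ?memden ?memnum;
    by clear -lb vl bl bk ek; lia.
have [|v0 v1] := @upper_mull_supp T z (idx k) UT.
  by move=> b; rewrite zE vk => hb; rewrite ifN //; clear -hb ek ij; lia.
have vK b : b \notin itv 1 k -> (T *m z) b 0 = 0.
  by rewrite inE => bk; apply: v0; rewrite vk; clear -bk ek i1 ij; lia.
have xv0 a : a \in itv i j -> a != idx i -> (x *m (T *m z)) a 0 = 0.
  rewrite inE -val_eqE /= vi => ha ai; rewrite xvE // Y0 ?mulr0 ?oppr0 // vl.
  by clear -ha ai i1 ij jm; lia.
have := quasidet_col Dx iI kK cIK vK xv0.
rewrite xvE ?vi; last by clear -i1 ij; lia.
rewrite Y1 ?vi ?vl; last by clear -i1 ij jm; lia.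
rewrite v1 zE vk ifT; last by clear -ek i1 ij; lia.
(* The index [k] is not in [Jnum], so the pivot entry of [r] is [- c]. *)
rewrite rE q1 mul1r pJ ?sub0r; last by rewrite memnum vk; clear -ek i1 ij jm; lia.
rewrite -exprD (@eq_sign _ (_ + _) 0) ?mulr1 ?addnn ?odd_double //.
by rewrite !mulrN => /oppr_inj ->.
Qed.

(** Both column sets for [y] have [i - 1] elements above their pivot, so these signs cancel in the
    ratio; the remaining sign is that of the quasiminor of [x]. *)
Lemma left_columns_Delta d A T x y i j : half_related d A T y x ->
  (1 <= i)%N -> (i <= j)%N -> (j <= m)%N ->
  let k := (j + 1 - i)%N in
  let Jden : {set 'I_n} := itv (n + 2 - i) n :|: itv 1 k in
  let Jnum : {set 'I_n} := itv (n + 1 - i) n :|: itv 1 (j - i) in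
  Delta_defined (itv i j) (itv 1 k) (idx i) (idx k) x ->
  Delta_defined (itv 1 j) Jden (idx j) (idx k) y ->
  Delta_defined (itv 1 j) Jnum (idx j) (idx (n + 1 - i)) y ->
  Delta (itv 1 j) Jden (idx j) (idx k) y \is a GRing.unit ->
  d 0 (idx i) = Delta (itv i j) (itv 1 k) (idx i) (idx k) x
    * ((Delta (itv 1 j) Jden (idx j) (idx k) y)^-1
       * Delta (itv 1 j) Jnum (idx j) (idx (n + 1 - i)) y).
Proof.
move=> rel i1 ij jm k Jden Jnum Dx Dyd Dyn.
have sden : (num_above (itv 1 j) (idx j : 'I_n) + num_above Jden (idx k) = i.-1)%N.
  by rewrite num_aboveU ?disjoint_itv ?num_above_itv; lia.
have snum : (num_above (itv 1 j) (idx j : 'I_n)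
    + num_above Jnum (idx (n + 1 - i)) = i.-1)%N.
  by rewrite num_aboveU ?disjoint_itv ?num_above_itv; lia.
have sx : (num_above (itv i j) (idx i : 'I_n)
    + num_above (itv 1 k) (idx k : 'I_n) = j - i)%N.
  by rewrite !num_above_itv; lia.
rewrite /Delta sden snum sx unitrMr ?sign_unit // => uq.
rewrite (left_columns_quasidet rel i1 ij jm Dx Dyd Dyn uq) invrM ?sign_unit //.
by rewrite -(mulrA (_^-1)) mulKr ?sign_unit // (mulrA _ ((-1) ^+ _)) commr_sign.
Qed.
End TwistPairs.

(** * The lift of the longest element *)

Section ReducedWords.
Variable m : nat.
Local Notation n := m.+1.
Implicit Types (w : 'S_n) (j : 'I_m) (a b c : 'I_n).

(** Inversions are attributed to their later position because this count is the sign exponent of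
    that column in the lift. *)
Definition inv_below w b : nat := #|[set c : 'I_n | (c < b)%N && (w b < w c)%N]|.

Definition inversions w : nat := (\sum_b inv_below w b)%N.

Lemma simpleE j a : simple j a =
  (if a == j :> nat then j.+1 else if a == j.+1 :> nat then j : nat else a) :> nat.
Proof.
have hj := ltn_ord j; rewrite /simple.
have e1 : (inord j : 'I_n) = j :> nat by rewrite inordK; lia.
have e2 : (inord j.+1 : 'I_n) = j.+1 :> nat by rewrite inordK; lia.
case: tpermP => [->|->|n1 n2]; rewrite ?e1 ?e2 ?eqxx //.
  by rewrite ifN //; lia.
have {}n1 : a != inord j by apply/eqP.
have {}n2 : a != inord j.+1 by apply/eqP.
by move: n1 n2; rewrite -!val_eqE /= e1 e2 => /negPf -> /negPf ->.
Qed.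

Lemma simpleK j w : (w * simple j * simple j)%g = w.
Proof. by rewrite -mulgA /simple tperm2 mulg1. Qed.

(** Exchanging the values [j] and [j + 1] alters the relative order of the positions [p] and [q]
    only; the new inversion is counted at the later one, [q]. *)
Lemma ascentP w j (p q b : 'I_n) : w p = j :> nat -> w q = j.+1 :> nat ->
  (p < q)%N -> inv_below (w * simple j)%g b = (inv_below w b + (b == q))%N.
Proof.
move=> wp wq pq.
have inj_w c c' : w c = w c' :> nat -> c = c' by move=> /val_inj/perm_inj.
have wpE c : (w c == j :> nat) = (c == p).
  by apply/eqP/eqP => [e|->//]; apply: inj_w; rewrite e.
have wqE c : (w c == j.+1 :> nat) = (c == q).
  by apply/eqP/eqP => [e|->//]; apply: inj_w; rewrite e.
have sE c : simple j (w c)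
    = (if c == p then j.+1 else if c == q then j : nat else w c) :> nat.
  by rewrite simpleE wpE wqE.
have qp : (q == p) = false by rewrite -val_eqE /=; lia.
rewrite /inv_below; have [->|bq] := eqVneq b q.
  set X := [set c | _]; set Y := [set c | _].
  have -> : X = p |: Y; last first.
    by rewrite cardsU1 inE wp wq pq /=; lia.
  apply/setP=> c; rewrite !inE !permM !sE eqxx qp wq.
  have := wpE c; have := wqE c.
  have [->|cp] := eqVneq c p; first by lia.
  by have [->|cq] := eqVneq c q; lia.
rewrite addn0; apply: eq_card => c; rewrite !inE !permM !sE (negPf bq).
have := wpE c; have := wqE c; have := wpE b; have := wqE b; rewrite (negPf bq).
rewrite -!(inj_eq val_inj) /=; have [ebp|bp] := eqVneq (b : nat) p;
  have [ecp|cp] := eqVneq (c : nat) p; have [ecq|cq] := eqVneq (c : nat) q; lia.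
Qed.

Lemma inversions_ascent w j (p q : 'I_n) : w p = j :> nat -> w q = j.+1 :> nat ->
  (p < q)%N -> inversions (w * simple j)%g = (inversions w).+1.
Proof.
move=> wp wq pq; rewrite /inversions.
under eq_bigr do rewrite (ascentP _ wp wq pq).
rewrite big_split /= -[in RHS]addn1; congr (_ + _)%N.
by rewrite (bigD1 q) //= eqxx big1 ?addn0 // => b /negPf ->.
Qed.

Lemma preim_simple w j : exists p q, w p = j :> nat /\ w q = j.+1 :> nat.
Proof.
have hj := ltn_ord j.
exists (w^-1%g (inord j)), (w^-1%g (inord j.+1)).
by rewrite !permKV !inordK //; lia.
Qed.

Lemma inversions_descent w j (p q : 'I_n) : w p = j :> nat -> w q = j.+1 :> nat ->
  (q < p)%N -> inversions w = (inversions (w * simple j)%g).+1.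
Proof.
move=> wp wq qp; rewrite -{1}(simpleK j w).
apply: (@inversions_ascent _ _ q p) => //; rewrite permM simpleE.
  by rewrite wq eqxx ifN //; lia.
by rewrite wp eqxx.
Qed.

(** Induction from the left end bounds each value below by its position, and induction from the
    right end bounds it above. *)
Lemma increasing_perm1 (v : 'S_n) :
  (forall j, (v (inord j) < v (inord j.+1))%N) -> v = 1%g.
Proof.
move=> incr.
have lev k : (k <= m)%N -> (k <= v (inord k))%N.
  elim: k => // k IHk km; have := incr (Ordinal km); have := IHk (ltnW km) => /=.
  by lia.
have gev k : (k <= m)%N -> (v (inord (m - k)) <= m - k)%N.
  elim: k => [_|k IHk km]; first by rewrite subn0 -ltnS ltn_ord.
  have hk : (m - k.+1 < m)%N by lia.
  have := incr (Ordinal hk); have := IHk (ltnW km) => /=.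
  have -> : (m - k.+1).+1 = (m - k)%N by lia.
  by lia.
apply/permP=> a; rewrite perm1; apply/val_inj/eqP.
have am : (a <= m)%N by rewrite -ltnS ltn_ord.
have := lev a am; have := gev (m - a)%N (leq_subr _ _).
by rewrite subKn // inord_val eqn_leq => -> ->.
Qed.

Lemma exists_descent w : w != 1%g -> exists j (p q : 'I_n),
  [/\ w p = j :> nat, w q = j.+1 :> nat & (q < p)%N].
Proof.
move=> w1; suff /existsP[j hj] :
    [exists j : 'I_m, (w^-1%g (inord j.+1) < w^-1%g (inord j))%N].
  have jm := ltn_ord j; exists j, (w^-1%g (inord j)), (w^-1%g (inord j.+1)).
  by rewrite !permKV !inordK //; lia.
apply: contraR w1; rewrite negb_exists => /forallP incr.
rewrite -eq_invg1; apply/eqP/increasing_perm1 => j.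
have := incr j; rewrite -leqNgt leq_eqVlt => /orP[/eqP/val_inj/perm_inj|//].
by have hj := ltn_ord j; move=> /(congr1 val); rewrite /= !inordK; lia.
Qed.

(** Bubble sort: each descent removed costs one letter and one inversion. With [inversions_word],
    this identifies the inversion number with the reduced length. *)
Lemma word_of_inversions w : exists2 ws, word_perm ws = w & size ws = inversions w.
Proof.
have [k] := ubnP (inversions w); elim: k w => // k IHk w hk.
have [->|/exists_descent[j [p [q [wp wq qp]]]]] := eqVneq w 1%g.
  exists [::] => //; rewrite /inversions big1 // => b _.
  by apply/eqP; rewrite cards_eq0; apply/eqP/setP=> c; rewrite !inE !perm1; lia.
have e := inversions_descent wp wq qp.
have [|ws wsE szE] := IHk (w * simple j)%g; first by lia.
by exists (j :: ws); rewrite /= ?wsE ?simpleK // szE e.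
Qed.

Lemma inversions_cons w j : (inversions (w * simple j)%g <= (inversions w).+1)%N.
Proof.
have [p [q [wp wq]]] := preim_simple w j.
case: (ltngtP p q) => [pq|qp|/val_inj e]; first by rewrite (inversions_ascent wp wq pq).
  by rewrite (inversions_descent wp wq qp); lia.
by move: wq; rewrite -e wp; lia.
Qed.

Lemma inversions_word ws : (inversions (word_perm ws) <= size ws)%N.
Proof.
elim: ws => [|j ws IHws] /=.
  rewrite /inversions big1 // => b _.
  by apply/eqP; rewrite cards_eq0; apply/eqP/setP=> c; rewrite !inE !perm1; lia.
exact: leq_trans (inversions_cons _ _) _.
Qed.

Variable F : unitRingType.

(** A closed form of the lift that makes no reference to a word. *)
Definition signed_perm w : 'M[F]_n :=
  \matrix_(a, b) ((a == w b)%:R * (-1) ^+ inv_below w b).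

Lemma simple_barE j a b :
  simple_bar F j a b = (a == simple j b)%:R * (-1) ^+ (b == j.+1 :> nat).
Proof.
rewrite mxE -!val_eqE /= simpleE; have [->|bj] := eqVneq (b : nat) j.
  have -> : (j == j.+1 :> nat) = false by lia.
  by rewrite andbF andbT expr0 mulr1; case: eqP => // _; case: (_ == j :> nat).
have [->|bj'] := eqVneq (b : nat) j.+1; last first.
  rewrite !andbF expr0 mulr1; congr (_%:R); congr nat_of_bool.
  by case: eqP => [->|]; rewrite ?bj.
rewrite /= andbT andbF expr1; case: (_ == j :> nat); rewrite ?mul1r ?mul0r //.
by case: (_ == j.+1 :> nat).
Qed.

(** The entry -1 of [simple_bar F j] is in column [j + 1], so it flips the sign of column [q],
    exactly where [inv_below] grows. *)
Lemma signed_perm_ascent w j (p q : 'I_n) : w p = j :> nat -> w q = j.+1 :> nat ->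
  (p < q)%N -> simple_bar F j *m signed_perm w = signed_perm (w * simple j)%g.
Proof.
move=> wp wq pq; apply/matrixP=> a b; rewrite !mxE (bigD1 (w b)) //= big1 ?addr0.
  rewrite simple_barE mxE eqxx mul1r permM (ascentP b wp wq pq) -mulrA -exprD addnC.
  congr (_ * (-1) ^+ (_ + nat_of_bool _)).
  by apply/eqP/eqP => [e|->//]; apply/(@perm_inj _ w)/val_inj; rewrite /= e.
by move=> c /negPf cb; rewrite [signed_perm _ _ _]mxE cb mul0r mulr0.
Qed.

Lemma signed_perm1 : signed_perm 1%g = 1%:M.
Proof.
apply/matrixP=> a b; rewrite !mxE perm1 [inv_below _ _](_ : _ = 0%N) ?mulr1 //.
by apply/eqP; rewrite cards_eq0; apply/eqP/setP=> c; rewrite !inE !perm1; lia.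
Qed.

(** A letter adds at most one inversion, so equality of size and inversion number forces an ascent
    at every letter. *)
Lemma prod_reduced_word ws : size ws = inversions (word_perm ws) ->
  \big[mulmx/1%:M]_(j <- ws) simple_bar F j = signed_perm (word_perm ws).
Proof.
elim: ws => [|j ws IHws] /= szE; first by rewrite big_nil signed_perm1.
have le1 := inversions_word ws; have le2 := inversions_cons (word_perm ws) j.
have [p [q [wp wq]]] := preim_simple (word_perm ws) j.
rewrite big_cons IHws; last by lia.
case: (ltngtP p q) => [pq|qp|/val_inj e]; first exact: signed_perm_ascent pq.
  by have := inversions_descent wp wq qp; lia.
by move: wq; rewrite -e wp; lia.
Qed.

Lemma barE w : bar F w = signed_perm w.
Proof.
rewrite /bar; set ws := classical_sets.xget _ _.
have [ws0 ws0E sz0] := word_of_inversions w.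
have [wsE wsmin] : reduced_word w ws.
  apply: classical_sets.xgetPex; exists ws0; split=> // ws' ws'E.
  by rewrite sz0 -ws'E inversions_word.
rewrite prod_reduced_word wsE //; apply/eqP; rewrite eqn_leq.
by rewrite -{1}sz0 wsmin //= -{1}wsE inversions_word.
Qed.

(** All pairs of positions are inverted, so the sign exponent is the 0-based column index. *)
Lemma bar_w0E a b : bar F w0 a b = (a + b == m)%N%:R * (-1) ^+ b.
Proof.
rewrite barE mxE permE /= -val_eqE /=.
have hb := ltn_ord b.
have -> : (a == (n - b.+1)%N :> nat) = (a + b == m)%N by lia.
congr (_ * (-1) ^+ _); rewrite /inv_below.
have -> : [set c : 'I_n | (c < b)%N && (w0 b < w0 c)%N] = itv 1 b.
  by apply/setP=> c; rewrite !inE !permE /=; have := ltn_ord c; lia.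
by rewrite card_itv //; lia.
Qed.

End ReducedWords.

(** * Gaussian factorizations and the twist *)

Section Triangular.
Variables (F : unitRingType) (n : nat).
Implicit Types A B T : 'M[F]_n.

Lemma upper_mxP T : reflect (forall a b : 'I_n, (b < a)%N -> T a b = 0) (is_trig_mx T^T).
Proof.
by apply: (iffP is_trig_mxP) => T0 a b ab; [have := T0 b a ab|]; rewrite mxE ?T0.
Qed.

Lemma is_inverse_sym A B : is_inverse A B -> is_inverse B A.
Proof. by case. Qed.

Lemma is_inverse_mul A A' B B' :
  is_inverse A A' -> is_inverse B B' -> is_inverse (A *m B) (B' *m A').
Proof.
move=> [AA' A'A] [BB' B'B]; split.
  by rewrite -mulmxA (mulmxA B) BB' mul1mx.
by rewrite -mulmxA (mulmxA A') A'A mul1mx.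
Qed.

Lemma trig_mul A B : is_trig_mx A -> is_trig_mx B ->
  is_trig_mx (A *m B) /\ forall a, (A *m B) a a = A a a * B a a.
Proof.
move=> /is_trig_mxP A0 /is_trig_mxP B0; split.
  apply/is_trig_mxP=> a b ab; rewrite mxE big1 // => c _.
  by case: (ltnP a c) => ac; [rewrite A0 ?mul0r|rewrite B0 ?mulr0] => //; lia.
move=> a; rewrite mxE (bigD1 a) //= big1 ?addr0 // => c; rewrite -val_eqE /= => ca.
by case: (ltnP a c) => ac; [rewrite A0 ?mul0r|rewrite B0 ?mulr0] => //; lia.
Qed.

Lemma upper_mul A B : is_trig_mx A^T -> is_trig_mx B^T ->
  is_trig_mx (A *m B)^T /\ forall a, (A *m B) a a = A a a * B a a.
Proof.
move=> /upper_mxP A0 /upper_mxP B0; split.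
  apply/upper_mxP=> a b ab; rewrite mxE big1 // => c _.
  by case: (ltnP c a) => ac; [rewrite A0 ?mul0r|rewrite B0 ?mulr0] => //; lia.
move=> a; rewrite mxE (bigD1 a) //= big1 ?addr0 // => c; rewrite -val_eqE /= => ca.
by case: (ltnP c a) => ac; [rewrite A0 ?mul0r|rewrite B0 ?mulr0] => //; lia.
Qed.

Lemma trig_diag (d : 'rV[F]_n) :
  is_trig_mx (diag_mx d : 'M[F]_n) /\ is_trig_mx (diag_mx d : 'M[F]_n)^T.
Proof. by rewrite tr_diag_mx diag_mx_is_trig. Qed.

Lemma diag_is_inverse (d : 'rV[F]_n) : (forall a, d 0 a \is a GRing.unit) ->
  is_inverse (diag_mx d) (diag_mx (\row_a (d 0 a)^-1)).
Proof.
move=> du; split; apply/matrixP=> a b; rewrite mul_diag_mx !mxE;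
  by case: eqP => [->|_]; rewrite ?mulr0 // !mulr1n ?mulrV ?mulVr.
Qed.

Hypothesis skewF : GRing.field_axiom F.

(** Induction on the rows of [B]: once the earlier rows are known to be triangular, row [a] of
    [A *m B = 1] reduces on and right of the diagonal to its single term with [A a a]. *)
Lemma lower_inverse A B : is_trig_mx A -> is_inverse A B ->
  [/\ is_trig_mx B, forall a, A a a \is a GRing.unit
    & forall a, B a a \is a GRing.unit].
Proof.
move=> /is_trig_mxP A0 [AB BA].
have row k : forall a : 'I_n, (a < k)%N ->
    (forall b : 'I_n, (a < b)%N -> B a b = 0) /\ A a a * B a a = 1.
  elim: k => // k IHk a ak.
  have AaB (b : 'I_n) : (a <= b)%N -> A a a * B a b = (a == b)%:R.
    move=> ab; have := congr1 (fun M : 'M_n => M a b) AB; rewrite !mxE (bigD1 a) //=.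
    rewrite big1 ?addr0 // => c; rewrite -val_eqE /= => ca.
    case: (ltnP a c) => ac; first by rewrite A0 ?mul0r.
    by rewrite (proj1 (IHk c _)) ?mulr0 //; lia.
  have Aaa := AaB a (leqnn _); rewrite eqxx in Aaa.
  split=> // b ab; have Au : A a a \is a GRing.unit.
    by apply: skewF; apply/eqP=> A00; move/eqP: Aaa; rewrite A00 mul0r eq_sym oner_eq0.
  apply: (mulrI Au); rewrite mulr0 AaB ?(ltnW ab) //.
  by rewrite -val_eqE /= ltn_eqF.
split=> [|a|a]; first by apply/is_trig_mxP=> a b; apply: (proj1 (row _ _ (ltn_ord a))).
  apply: skewF; apply/eqP=> A00; have [_ /eqP] := row _ _ (ltn_ord a).
  by rewrite A00 mul0r eq_sym oner_eq0.
apply: skewF; apply/eqP=> A00; have [_ /eqP] := row _ _ (ltn_ord a).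
by rewrite A00 mulr0 eq_sym oner_eq0.
Qed.

Lemma upper_diag_unit A B : is_trig_mx A^T -> is_inverse A B ->
  forall a, A a a \is a GRing.unit.
Proof.
move=> /upper_mxP A0 [AB BA].
have row k : forall a : 'I_n, (a < k)%N ->
    (forall b : 'I_n, (a < b)%N -> B b a = 0) /\ B a a * A a a = 1.
  elim: k => // k IHk a ak.
  have BaA (b : 'I_n) : (a <= b)%N -> B b a * A a a = (b == a)%:R.
    move=> ab; have := congr1 (fun M : 'M_n => M b a) BA; rewrite !mxE (bigD1 a) //=.
    rewrite big1 ?addr0 // => c; rewrite -val_eqE /= => ca.
    case: (ltnP a c) => ac; first by rewrite A0 ?mulr0.
    by rewrite (proj1 (IHk c _)) ?mul0r //; lia.
  have Aaa := BaA a (leqnn _); rewrite eqxx in Aaa.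
  split=> // b ab; have Au : A a a \is a GRing.unit.
    by apply: skewF; apply/eqP=> A00; move/eqP: Aaa; rewrite A00 mulr0 eq_sym oner_eq0.
  apply: (mulIr Au); rewrite mul0r BaA ?(ltnW ab) //.
  by rewrite -val_eqE /= gtn_eqF.
move=> a; apply: skewF; apply/eqP=> A00; have [_ /eqP] := row _ _ (ltn_ord a).
by rewrite A00 mulr0 eq_sym oner_eq0.
Qed.

Lemma upper_split T : is_trig_mx T^T -> (forall a, T a a \is a GRing.unit) ->
  exists (d : 'rV[F]_n) (U : 'M[F]_n),
    [/\ forall a, d 0 a \is a GRing.unit, in_U U & T = diag_mx d *m U].
Proof.
move=> Tu Tdu; pose d : 'rV_n := \row_a T a a.
have du a : d 0 a \is a GRing.unit by rewrite mxE.
exists d, (diag_mx (\row_a (d 0 a)^-1) *m T); split=> //.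
  split=> [|a]; last by rewrite mul_diag_mx !mxE mulVr.
  by case: (upper_mul (proj2 (trig_diag (\row_a (d 0 a)^-1))) Tu).
by rewrite mulmxA (proj1 (diag_is_inverse du)) mul1mx.
Qed.

End Triangular.

(** * Inverses of unitriangular matrices *)

Section Unitriangular.
Variables (F : unitRingType) (m : nat).
Local Notation n := m.+1.
Implicit Types T : 'M[F]_n.

Lemma in_U_mul S T : in_U S -> in_U T -> in_U (S *m T : 'M[F]_n).
Proof.
move=> [Su S1] [Tu T1]; have [STu ST1] := upper_mul Su Tu.
by split=> // a; rewrite ST1 S1 T1 mulr1.
Qed.

(** Back substitution without division: subtracting the image of the last nonzero coordinate
    shortens the support of the right-hand side. The columns of the inverse solve the systems for
    the basis vectors. *)
Lemma in_U_right_inverse T : in_U T -> exists2 S, in_U S & T *m S = 1%:M.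
Proof.
move=> UT.
have solve k (v : 'cV[F]_n) : (forall a : 'I_n, (k <= a)%N -> v a 0 = 0) ->
    exists2 s : 'cV[F]_n, forall a : 'I_n, (k <= a)%N -> s a 0 = 0 & T *m s = v.
  elim: k v => [|k IHk] v v0.
    by exists v => //; rewrite (_ : v = 0) ?mulmx0 //; apply/colP=> a; rewrite v0 ?mxE.
  case: (ltnP k n) => kn; last first.
    by have [|s s0 sE] := IHk v; [move=> a ka; have := ltn_ord a; lia|];
      exists s => // a ka; apply: s0; lia.
  pose a := Ordinal kn; pose g : 'cV[F]_n := delta_mx a 0 *m (v a 0)%:M.
  have gE b : g b 0 = (b == a)%:R * v a 0.
    by rewrite mxE big_ord1 !mxE eqxx andbT mulr1n.
  have [|g0 g1] := @upper_mull_supp _ _ T g a UT.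
    by move=> b ab; rewrite gE -val_eqE /= gtn_eqF ?mul0r.
  have [|s s0 sE] := IHk (v - T *m g).
    move=> b; rewrite leq_eqVlt => /orP[/eqP kb|kb]; rewrite mxE [X in _ + X]mxE.
      have -> : b = a by apply/val_inj.
      by rewrite g1 gE eqxx mul1r subrr.
    by rewrite v0 // g0 ?subrr.
  exists (g + s); last by rewrite mulmxDr sE addrC subrK.
  move=> b kb; rewrite mxE gE s0 ?(ltnW kb) // -val_eqE /= gtn_eqF //.
  by rewrite mul0r addr0.
have col_ex (b : 'I_n) : exists s : 'cV[F]_n,
    (forall a : 'I_n, (b < a)%N -> s a 0 = 0) /\ T *m s = delta_mx b 0.
  have [|s s0 sE] := solve (b : 'I_n).+1 (delta_mx b 0); last by exists s.
  by move=> a ba; rewrite mxE andbT -val_eqE /= gtn_eqF.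
have [f fP] := fin_all_exists col_ex.
have TS : T *m (\matrix_(a, b) f b a 0) = 1%:M.
  apply/matrixP=> a b; have := congr1 (fun M : 'cV_n => M a 0) (proj2 (fP b)).
  rewrite !mxE andbT => <-; apply: eq_bigr => c _; by rewrite mxE.
exists (\matrix_(a, b) f b a 0) => //; split.
  by apply/upper_mxP=> a b ba; rewrite mxE (proj1 (fP b)).
move=> a; rewrite mxE -(proj2 (upper_mull_supp UT (proj1 (fP a)))).
by rewrite (proj2 (fP a)) mxE !eqxx.
Qed.

(** The right inverse is again in U and has its own right inverse, which makes it two-sided. *)
Lemma in_U_inverse T : in_U T -> exists2 S, in_U S & is_inverse T S.
Proof.
move=> /in_U_right_inverse[S US TS]; have [R _ SR] := in_U_right_inverse US.
exists S => //; split=> //; rewrite -[RHS]SR; congr (_ *m _).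
by rewrite -[LHS]mulmx1 -SR mulmxA TS mul1mx.
Qed.

End Unitriangular.

(** * Multiplication by the lift of the longest element *)

Section LongestElement.
Variables (F : unitRingType) (m : nat).
Local Notation n := m.+1.
Local Notation K M := (Jmx F n *m M *m Jmx F n).
Local Notation W := (bar F (w0 : 'S_n)).
Local Notation P := (permG F (w0 : 'S_n)).
Implicit Types (M : 'M[F]_n) (a b : 'I_n).

Lemma w0V : (w0^-1 = w0 :> 'S_n)%g.
Proof.
apply/eqP; rewrite eq_invg_mul; apply/eqP/permP=> a.
by rewrite permM !permE /= rev_ordK.
Qed.

Lemma anti_sum (f : 'I_n -> F) a :
  \sum_(c : 'I_n) (a + c == m)%N%:R * f c = f (rev_ord a).
Proof.
have ha := ltn_ord a.
have E (c : 'I_n) : (a + c == m)%N = (c == rev_ord a).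
  by rewrite -val_eqE /=; have := ltn_ord c; lia.
rewrite (bigD1 (rev_ord a)) // E eqxx mul1r big1 => [|c]; first by rewrite /= addr0.
by rewrite E => /negPf ->; rewrite mul0r.
Qed.

Lemma anti_sumr (f : 'I_n -> F) a :
  \sum_(c : 'I_n) f c * (c + a == m)%N%:R = f (rev_ord a).
Proof.
have ha := ltn_ord a.
have E (c : 'I_n) : (c + a == m)%N = (c == rev_ord a).
  by rewrite -val_eqE /=; have := ltn_ord c; lia.
rewrite (bigD1 (rev_ord a)) // E eqxx mulr1 big1 => [|c]; first by rewrite /= addr0.
by rewrite E => /negPf ->; rewrite mulr0.
Qed.

Lemma mul_w0bar M a b : (W *m M) a b = (-1) ^+ rev_ord a * M (rev_ord a) b.
Proof.
rewrite mxE -(anti_sum (fun c => (-1) ^+ c * M c b)); apply: eq_bigr => c _.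
by rewrite bar_w0E mulrA.
Qed.

Lemma mulmx_w0bar M a b : (M *m W) a b = M a (rev_ord b) * (-1) ^+ b.
Proof.
rewrite mxE -(anti_sumr (fun c => M a c * (-1) ^+ b)); apply: eq_bigr => c _.
by rewrite bar_w0E -commr_nat mulrA.
Qed.

Lemma Kw0barE a b : K W a b = (a + b == m)%N%:R * (-1) ^+ a.
Proof.
rewrite Jmx_sandwichE bar_w0E -commr_sign -mulrA -exprD.
by congr (_ * _); apply: eq_sign; lia.
Qed.

Lemma mul_Kw0bar M a b : (K W *m M) a b = (-1) ^+ a * M (rev_ord a) b.
Proof.
rewrite mxE -(anti_sum (fun c => (-1) ^+ a * M c b)); apply: eq_bigr => c _.
by rewrite Kw0barE mulrA.
Qed.

Lemma mulmx_Kw0bar M a b : (M *m K W) a b = M a (rev_ord b) * (-1) ^+ rev_ord b.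
Proof.
rewrite mxE -(anti_sumr (fun c => M a c * (-1) ^+ c)); apply: eq_bigr => c _.
by rewrite Kw0barE -commr_nat mulrA.
Qed.

Lemma permG_w0E a b : P a b = (a + b == m)%N%:R.
Proof.
rewrite /permG w0V mxE mxE permE -val_eqE /=; congr (nat_of_bool _)%:R.
by have := ltn_ord a; have := ltn_ord b; lia.
Qed.

Lemma mul_permw0 M a b : (P *m M) a b = M (rev_ord a) b.
Proof.
by rewrite mxE -(anti_sum (fun c => M c b)); apply: eq_bigr => c _; rewrite permG_w0E.
Qed.

Lemma w0bar_inverse : is_inverse W (K W).
Proof.
have WK : W *m K W = 1%:M.
  apply/matrixP=> a b; rewrite mul_w0bar Kw0barE commr_sign mulrA -exprD.
  rewrite (@eq_sign _ (_ + _) 0) ?mul1r ?addnn ?odd_double // mxE.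
  congr (nat_of_bool _)%:R; rewrite -val_eqE /=; have := ltn_ord a; lia.
(* Conjugation by [Jmx] is a multiplicative involution, so applying it to one inverse identity gives
   the other. *)
by split=> //; rewrite -[X in _ *m X](Jmx_sandwichK W) -Jmx_sandwichM WK mulmx1 Jmx_invol.
Qed.

End LongestElement.

(** * The factorizations defining the twist *)

Section TwistRelated.
Variables (F : unitRingType) (skewF : GRing.field_axiom F) (m : nat).
Local Notation n := m.+1.
Local Notation K M := (Jmx F n *m M *m Jmx F n).
Local Notation W := (bar F (w0 : 'S_n)).
Local Notation P := (permG F (w0 : 'S_n)).
Implicit Types x y M : 'M[F]_n.

Lemma Bminus_w0_mul (d : 'rV[F]_n) x : (forall a, d 0 a \is a GRing.unit) ->
  in_BminusvBminus w0 x -> in_BminusvBminus w0 (diag_mx d *m x).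
Proof.
move=> du [c1 [c2 [[[c1i c1I] c1l] Bc2 ->]]]; exists (diag_mx d *m c1), c2.
split=> //; last by rewrite !mulmxA.
split; last by case: (trig_mul (proj1 (trig_diag d)) c1l).
by eexists; apply: is_inverse_mul (diag_is_inverse du) c1I.
Qed.

(** The diagonal of the right factor is moved through the permutation matrix to the left and then
    collected in H together with that of the left factor. *)
Lemma HL_exists x : double_cell w0 w0 x -> exists p, is_HL w0 w0 x p.
Proof.
case=> [[b1 [b2 [[[b1i b1I] b1u] [[b2i b2I] b2u] xE]]] xB].
have [d2 [a2 [d2u Ua2 b2E]]] := upper_split b2u (upper_diag_unit skewF b2u b2I).
have [WK KW] := w0bar_inverse F m.
(* Reversing [d2] accounts for the passage through [P], and the signs for replacing [P] by [W]. *)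
pose e : 'rV[F]_n := \row_a (d2 0 (rev_ord a) * (-1) ^+ rev_ord a).
have eu a : e 0 a \is a GRing.unit by rewrite mxE unitrMl ?sign_unit.
have DE : P *m diag_mx d2 = diag_mx e *m W.
  apply/matrixP=> a b; rewrite mul_permw0 mul_diag_mx !mxE bar_w0E.
  have <- : (rev_ord a == b) = (a + b == m)%N.
    by rewrite -val_eqE /=; have := ltn_ord a; have := ltn_ord b; lia.
  case: eqP => [<-|_]; last by rewrite mul0r mulr0.
  by rewrite mul1r -mulrA -exprD (@eq_sign _ (_ + _) 0) ?mulr1 // addnn odd_double.
have b1eu : is_trig_mx (b1 *m diag_mx e)^T.
  by case: (upper_mul b1u (proj2 (trig_diag e))).
have b1eI := is_inverse_mul b1I (diag_is_inverse eu).
have [h [a1 [hu Ua1 hE]]] := upper_split b1eu (upper_diag_unit skewF b1eu b1eI).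
have hI := diag_is_inverse hu.
exists (diag_mx h, a1 *m W *m a2); split=> /=.
- by split; [eexists; exact: hI|exact: diag_mx_is_diag].
- split; first by exists a1, a2.
  rewrite (_ : a1 *m W *m a2 = diag_mx (\row_a (h 0 a)^-1) *m x).
    by apply: Bminus_w0_mul => // a; rewrite mxE unitrV.
  rewrite xE b2E -(mulmxA b1) (mulmxA P) DE !mulmxA -(mulmxA _ b1) hE !mulmxA.
  by rewrite (proj2 hI) mul1mx.
- by rewrite xE b2E -(mulmxA b1) (mulmxA P) DE !mulmxA hE.
Qed.

(** Conjugation by the longest element makes the right lower triangular factor upper triangular; its
    diagonal then joins the left factor. *)
Lemma gauss_minus_exists x : in_BminusvBminus w0 x -> exists p, is_BminusU (x *m W) p.
Proof.
case=> [c1 [c2 [[[c1i c1I] c1l] [[c2i c2I] c2l] xE]]].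
have [_ c2u _] := lower_inverse skewF c2l c2I.
have QE a b : (P *m c2 *m W) a b = c2 (rev_ord a) (rev_ord b) * (-1) ^+ b.
  by rewrite mulmx_w0bar mul_permw0.
have Qu : is_trig_mx (P *m c2 *m W)^T.
  apply/upper_mxP=> a b ba; rewrite QE (is_trig_mxP c2l) ?mul0r //=.
  by have := ltn_ord a; lia.
have [|d [U [du UU QdU]]] := upper_split Qu.
  by move=> a; rewrite QE unitrMl ?sign_unit.
exists (c1 *m diag_mx d, U); split=> //=; last first.
  by rewrite xE -!mulmxA -QdU !mulmxA.
split; last by case: (trig_mul c1l (proj1 (trig_diag d))).
by eexists; apply: is_inverse_mul c1I (diag_is_inverse du).
Qed.

Lemma lower_unitriangular_conj (a1 : 'M[F]_n) : in_U a1 ->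
  [/\ in_Bminus (K W *m a1 *m W) & forall a, (K W *m a1 *m W) a a = 1].
Proof.
move=> Ua; have [S US aI] := in_U_inverse Ua.
have E (a b : 'I_n) : (K W *m a1 *m W) a b
    = (-1) ^+ a * a1 (rev_ord a) (rev_ord b) * (-1) ^+ b.
  by rewrite mulmx_w0bar mul_Kw0bar.
have WI := w0bar_inverse F m.
split; last first.
  move=> a; rewrite E (proj2 Ua) mulr1 -exprD (@eq_sign _ (_ + _) 0) //.
  by rewrite addnn odd_double.
split.
  by eexists; apply: is_inverse_mul (is_inverse_mul (is_inverse_sym WI) aI) WI.
apply/is_trig_mxP=> a b ab; rewrite E.
by have /upper_mxP -> := proj1 Ua; rewrite ?mulr0 ?mul0r //=; have := ltn_ord b; lia.
Qed.

(** The Gauss factors are known only through their specification. Here [X] is also lower triangular,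
    being the inverse of [L] times [M], so the diagonals multiply. *)
Lemma lower_unitriangular_unique (L X M : 'M[F]_n) :
  in_Bminus L -> in_U X -> in_Bminus M -> (forall a, M a a = 1) ->
  L *m X = M -> forall a, L a a = 1.
Proof.
move=> [[Li LI] Ll] [Xu X1] [_ Ml] M1 E a.
have [Lil _ _] := lower_inverse skewF Ll LI.
have Xl : is_trig_mx X.
  have -> : X = Li *m M by rewrite -E mulmxA (proj2 LI) mul1mx.
  by case: (trig_mul Lil Ml).
by have := M1 a; rewrite -E (proj2 (trig_mul Ll Xl)) X1 mulr1.
Qed.

Lemma twist_half_related x : double_cell w0 w0 x ->
  exists (d : 'rV[F]_n) A T B S, [/\ forall a, d 0 a \is a GRing.unit,
    half_related d A T x (twist w0 w0 x) & half_related d B S (twist w0 w0 x) x].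
Proof.
move=> cx; rewrite /twist; set p := classical_sets.xget _ _.
have : is_HL w0 w0 x p by apply: classical_sets.xgetPex; apply: HL_exists.
case: p => h x' [/= [[hi hI] /diag_mxP[d hd]] [[a1 [a2 [Ua1 Ua2 x'a]]] x'B] xE].
rewrite {}hd in hI xE *.
have [hil du hiu] := lower_inverse skewF (proj1 (trig_diag d)) hI.
have {}du a : d 0 a \is a GRing.unit by have := du a; rewrite mxE eqxx mulr1n.
have WI := w0bar_inverse F m; have [WK KW] := WI.
rewrite /twist_reduced w0V (minv_eq WI) /gauss_minus /gauss_plus.
set p := classical_sets.xget _ _; set q := classical_sets.xget _ _.
have : is_BminusU (x' *m W) p.
  by apply: classical_sets.xgetPex; apply: gauss_minus_exists.
have : is_BminusU (K W *m x') q.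
  apply: classical_sets.xgetPex; exists (K W *m a1 *m W, a2); split=> //=.
    by case: (lower_unitriangular_conj Ua1).
  by rewrite x'a !mulmxA.
move: p q => [L1 U1] [L2 U2] [/= BL2 UU2 E2] [/= [[L1i L1I] L1l] UU1 E1].
have [S US U2I] := in_U_inverse UU2.
(* The decomposition of [x'] through U gives a second factorization of [K W *m x'], whose lower
   factor is unitriangular; comparing the two fixes the antidiagonal signs of V. *)
have L2_1 : forall a, L2 a a = 1.
  have [R UR a2I] := in_U_inverse Ua2.
  have [BM M1] := lower_unitriangular_conj Ua1.
  apply: (lower_unitriangular_unique BL2 (in_U_mul UU2 UR) BM M1).
  by rewrite mulmxA -E2 x'a -!mulmxA (proj1 a2I) mulmx1 !mulmxA.
have x'E1 : x' = L1 *m (U1 *m K W) by rewrite mulmxA -E1 -mulmxA WK mulmx1.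
have x'E2 : x' = W *m L2 *m U2 by rewrite -mulmxA -E2 mulmxA WK mul1mx.
have x'I : invertible x'.
  have [R1 _ I1] := in_U_inverse Ua1; have [R2 _ I2] := in_U_inverse Ua2.
  by rewrite x'a; eexists; apply: is_inverse_mul (is_inverse_mul I1 WI) I2.
have JI : is_inverse (Jmx F n) (Jmx F n) by split; apply: Jmx_invol.
(* The two inversions cancel, leaving only the conjugation by [Jmx]. *)
have minvK : minv (pos_inv x') = K x'.
  apply: minv_eq; rewrite /pos_inv -[X in is_inverse _ X]mulmxA.
  exact: is_inverse_mul (is_inverse_mul JI (is_inverse_sym (minvP x'I))) JI.
rewrite /pos_inv minvK (minv_eq L1I) (minv_eq U2I) -!Jmx_sandwichM.
have [L1il L1u L1iu] := lower_inverse skewF L1l L1I.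
set y := diag_mx d *m _.
(* [Z1] and [Z2] exhibit Z and V^K as lower triangular multiples of [x] and [y]. *)
have Z1 : L1i *m hi *m x = U1 *m K W.
  by rewrite xE mulmxA -(mulmxA L1i) (proj2 hI) mulmx1 x'E1 mulmxA (proj2 L1I) mul1mx.
have Z2 : K L1 *m hi *m y = K (W *m L2).
  rewrite /y mulmxA -(mulmxA (K L1)) (proj2 hI) mulmx1 -Jmx_sandwichM.
  rewrite -(mulmxA L1i) (mulmxA L1 L1i) (proj1 L1I) mul1mx x'E2.
  rewrite -(mulmxA (W *m L2)) (proj1 U2I).
  by rewrite mulmx1.
have KL1l : is_trig_mx (K L1).
  by apply/is_trig_mxP=> a b ab; rewrite Jmx_sandwichE (is_trig_mxP L1l) ?mulr0.
exists d, (L1i *m hi), (K U2), (K L1 *m hi), S; split=> //.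
- have [Al Ad] := trig_mul L1il hil; split=> //.
  + by move=> a; rewrite Ad unitrMl.
  + split=> [|a]; last by rewrite Jmx_sandwichE (proj2 UU2) mulr1 -signr_odd addnn odd_double.
    apply/upper_mxP=> a b ab; rewrite Jmx_sandwichE.
    by have /upper_mxP -> := proj1 UU2; rewrite ?mulr0.
  + rewrite Z1; split=> a b ab; rewrite mulmx_Kw0bar.
      by have /upper_mxP -> := proj1 UU1; rewrite ?mul0r //=; have := ltn_ord b; lia.
    have -> : rev_ord b = a by apply/val_inj => /=; have := ltn_ord b; lia.
    by rewrite (proj2 UU1) mul1r.
  + rewrite Z1 /y -mulmxA -Jmx_sandwichM -!(mulmxA L1i) -(mulmxA x') (proj2 U2I) mulmx1.
    by rewrite x'E1 (mulmxA L1i) (proj2 L1I) mul1mx.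
- have [Al Ad] := trig_mul KL1l hil; split=> //.
  + by move=> a; rewrite Ad unitrMl // Jmx_sandwichE unitrMr ?sign_unit.
  + rewrite Z2; split=> a b ab; rewrite Jmx_sandwichE mul_w0bar.
      by rewrite (is_trig_mxP (proj2 BL2)) ?mulr0 //=; have := ltn_ord a; lia.
    have -> : rev_ord a = b by apply/val_inj => /=; have := ltn_ord a; lia.
    by rewrite L2_1 mulr1 -exprD; apply: eq_sign; lia.
  + by rewrite Z2 Jmx_sandwichK xE x'E2 -!mulmxA (proj1 U2I) mulmx1.
Qed.

End TwistRelated.

(** * Cancellation of the common factors *)

Section Ratios.
Variables (F : unitRingType) (skewF : GRing.field_axiom F) (m : nat).
Local Notation n := m.+1.
Variables (d : 'rV[F]_n) (A B S T x y : 'M[F]_n).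
Hypotheses (du : forall a, d 0 a \is a GRing.unit).
Hypotheses (xy : half_related d A T x y) (yx : half_related d B S y x).
Hypotheses (okx : quasiminors_ok x) (oky : quasiminors_ok y).

Lemma top_rows_ratio i j : (1 <= i)%N -> (i <= j)%N -> (j <= n - 1)%N ->
  (Delta (itv 1 i :|: itv (n + i + 1 - j) n) (itv 1 j) (idx i) (idx j) y)^-1
  * Delta (itv 1 i :|: itv (n + i - j) n) (itv 1 (j + 1)) (idx i) (idx (j + 1)) y
  = (Delta (itv 1 i) (itv (j + 1 - i) j) (idx i) (idx j) x)^-1
    * Delta (itv 1 i) (itv (j - i + 2) (j + 1)) (idx i) (idx (j + 1)) x.
Proof.
move=> i1 ij jn; have jn1 : (j <= n)%N by lia.
have jn2 : (j + 1 <= n)%N by lia. have ij2 : (i <= j + 1)%N by lia.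
have e1 : (j - i + 2 = j + 1 + 1 - i)%N by lia.
have e2 : (n + i - j = n + i + 1 - (j + 1))%N by lia.
have [_ /(_ i j i1 ij jn) [_ [[[Dx /skewF ux] Dx'] _]]] := okx.
have [_ /(_ i j i1 ij jn) [[[Dy _] Dy'] _]] := oky.
rewrite e1 in Dx' *; rewrite e2 in Dy' *.
rewrite -(top_rows_Delta xy i1 ij jn1 Dx Dy) -(top_rows_Delta xy i1 ij2 jn2 Dx' Dy').
have uA : d 0 (idx i) * A (idx i) (idx i) \is a GRing.unit.
  by case: xy => _ uA _ _ _; rewrite unitrMl.
by rewrite invrM // -(mulrA (_^-1)) mulKr.
Qed.

(** The numerator on the side of [x] is an antidiagonal quasiminor, hence [d 0 (idx i)], which
    [left_columns_Delta] factors through the denominator. *)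
Lemma left_columns_ratio i j : (1 <= i)%N -> (i <= j)%N -> (j <= n - 1)%N ->
  (Delta (itv 1 j) (itv (n + 2 - i) n :|: itv 1 (j + 1 - i))
     (idx j) (idx (j + 1 - i)) y)^-1
  * Delta (itv 1 j) (itv (n + 1 - i) n :|: itv 1 (j - i))
      (idx j) (idx (n + 1 - i)) y
  = (Delta (itv i j) (itv 1 (j + 1 - i)) (idx i) (idx (j + 1 - i)) x)^-1
    * Delta (itv i n) (itv 1 (n + 1 - i)) (idx i) (idx (n + 1 - i)) x.
Proof.
move=> i1 ij jn; have jm : (j <= m)%N by lia.
have ei : (n + 1 - (n + 1 - i) = i)%N by lia.
have [_ /(_ i j i1 ij jn) [_ [_ [_ [[Dx /skewF ux] Dx']]]]] := okx.
have [_ /(_ i j i1 ij jn) [_ [_ [[[Dy /skewF uy] Dy'] _]]]] := oky.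
have := @antidiag_Delta _ _ d B S x y (n + 1 - i) yx; rewrite ei => -> //; last by lia.
by rewrite (left_columns_Delta yx i1 ij jm Dx Dy Dy' uy) mulKr.
Qed.

End Ratios.

Theorem theorem5p8 (F : unitRingType) (skewF : GRing.field_axiom F)
    (m : nat) (x y : 'M[F]_m.+1)
    (hx : double_cell w0 w0 x) (hy : y = twist w0 w0 x)
    (okx : quasiminors_ok x) (oky : quasiminors_ok y) :
  let n := m.+1 in
  (forall i : nat, (1 <= i <= n)%N ->
     Delta (itv (n + 1 - i) n) (itv 1 i) (idx (n + 1 - i)) (idx i) y =
     Delta (itv (n + 1 - i) n) (itv 1 i) (idx (n + 1 - i)) (idx i) x)
  /\
  (forall i j : nat, (1 <= i)%N -> (i <= j)%N -> (j <= n - 1)%N ->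
     [/\ (Delta (itv 1 i :|: itv (n + i + 1 - j) n) (itv 1 j)
            (idx i) (idx j) y)^-1
         * Delta (itv 1 i :|: itv (n + i - j) n) (itv 1 (j + 1))
            (idx i) (idx (j + 1)) y
         = (Delta (itv 1 i) (itv (j + 1 - i) j) (idx i) (idx j) x)^-1
           * Delta (itv 1 i) (itv (j - i + 2) (j + 1)) (idx i) (idx (j + 1)) x,
         (Delta (itv 1 i) (itv (j + 1 - i) j) (idx i) (idx j) y)^-1
         * Delta (itv 1 i) (itv (j - i + 2) (j + 1)) (idx i) (idx (j + 1)) y
         = (Delta (itv 1 i :|: itv (n + i + 1 - j) n) (itv 1 j)
              (idx i) (idx j) x)^-1
           * Delta (itv 1 i :|: itv (n + i - j) n) (itv 1 (j + 1))
              (idx i) (idx (j + 1)) x,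
         (Delta (itv 1 j) (itv (n + 2 - i) n :|: itv 1 (j + 1 - i))
            (idx j) (idx (j + 1 - i)) y)^-1
         * Delta (itv 1 j) (itv (n + 1 - i) n :|: itv 1 (j - i))
            (idx j) (idx (n + 1 - i)) y
         = (Delta (itv i j) (itv 1 (j + 1 - i)) (idx i) (idx (j + 1 - i)) x)^-1
           * Delta (itv i n) (itv 1 (n + 1 - i)) (idx i) (idx (n + 1 - i)) x
       & (Delta (itv i j) (itv 1 (j + 1 - i)) (idx i) (idx (j + 1 - i)) y)^-1
         * Delta (itv i n) (itv 1 (n + 1 - i)) (idx i) (idx (n + 1 - i)) y
         = (Delta (itv 1 j) (itv (n + 2 - i) n :|: itv 1 (j + 1 - i))
              (idx j) (idx (j + 1 - i)) x)^-1
           * Delta (itv 1 j) (itv (n + 1 - i) n :|: itv 1 (j - i))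
              (idx j) (idx (n + 1 - i)) x]).
Proof.
have [d [A [T [B [S [du xy yx]]]]]] := twist_half_related skewF hx.
rewrite -hy in xy yx; split=> [i hi|i j i1 ij jn].
  have [[Dx _] [Dy _]] := (okx, oky).
  by rewrite (antidiag_Delta xy hi (Dy i hi)) (antidiag_Delta yx hi (Dx i hi)).
split.
- exact: (top_rows_ratio skewF du xy okx oky).
(* The relation holds in both directions with the same [d], so exchanging [x] and [y] gives this
   identity, and likewise the last one. *)
- exact: (esym (top_rows_ratio skewF du yx oky okx _ _ _)).
- exact: (left_columns_ratio skewF yx okx oky).
- exact: (esym (left_columns_ratio skewF xy oky okx _ _ _)).
Qed.
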